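(* Let $(M,*,\mathfrak g,\mathbf J,C)$ be a Hamiltonian quantum $\mathfrak g$-space with regular constraint surface ($(M,\omega)$ symplectic). Suppose in addition that the first classical Chevalley-Eilenberg cohomology group on the constraint surface, $H^1_{\mathrm{CE}}(\mathfrak g,C^\infty(C))$, vanishes. Then the Hamiltonian quantum $\mathfrak g$-space $(M,*,\mathfrak g,\mathbf J,C)$ allows a consistent quantum reduction, i.e. $\mathbf H^0_{\mathrm{CE}}(\mathfrak g,C^\infty(C)[[\lambda]])\subset C^\infty(C)[[\lambda]]$ is a deformation of the subspace $C^\infty(C)^{\mathfrak g}\subset C^\infty(C)$ of classical invariants.
   Context: Setting. $(M,\omega)$ is symplectic, $\{f,g\}=\omega(X_f,X_g)$ with $i_{X_f}\omega=df$; functions are complex-valued. A star product $*$ is a $\mathbb C[[\lambda]]$-bilinear associative product $f*g=\sum_r\lambda^rC_r(f,g)$ on $C^\infty(M)[[\lambda]]$, $C_r$ bidifferential, $C_0(f,g)=fg$, $C_1(f,g)-C_1(g,f)=i\{f,g\}$, $C_r$ ($r\ge1$) vanishing on constants. $\mathfrak g$: real Lie algebra, $\dim\mathfrak g=n$, basis $e_a$, dual basis $e^a$, $[e_a,e_b]=\sum_cf^c{}_{ab}e_c$. Hamiltonian quantum $\mathfrak g$-space: $\mathbf J=J+O(\lambda)$ is a formal series of smooth maps $M\to\mathfrak g^*$, $J$ a classical momentum map ($\{\langle J,\xi\rangle,\langle J,\eta\rangle\}=\langle J,[\xi,\eta]\rangle$), and $\langle\mathbf J,\xi\rangle*\langle\mathbf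 J,\eta\rangle-\langle\mathbf J,\eta\rangle*\langle\mathbf J,\xi\rangle=i\lambda\langle\mathbf J,[\xi,\eta]\rangle$ for all $\xi,\eta\in\mathfrak g$. Regular constraint surface: $0$ is a regular value of $J$ and $C=J^{-1}(\{0\})\ne\emptyset$; $\iota:C\to M$ inclusion. $\xi_M=X_{\langle J,\xi\rangle}$ is tangent to $C$, with restriction $\xi_C$; the classical representation on $C^\infty(C)$ is $\varrho_C(\xi)u=-\xi_C(u)$, and $C^\infty(C)^{\mathfrak g}$ is its space of invariants. For a $\mathfrak g$-module $(Q,\rho)$ the Chevalley-Eilenberg differential on $\bigwedge\mathfrak g^*\otimes Q$ is $\alpha\otimes q\mapsto-\frac12\sum f^c{}_{ab}e^a\wedge e^b\wedge i(e_c)\alpha\otimes q+\sum_ae^a\wedge\alpha\otimes\rho(e_a)q$. $H^\bullet_{\mathrm{CE}}(\mathfrak g,C^\infty(C))$ is its cohomology for $\varrho_C$. Quantum representation. Let $\boldsymbol\varrho_M(\xi)f=\frac1{i\lambda}(\langle\mathbf J,\xi\rangle*f-f*\langle\mathbf J,\xi\rangle)$ on $C^\infty(M)[[\lambda]]$, $\chi(\xi)=\frac12\operatorname{tr}\operatorname{ad}(\xi)$, $J_a=\langle J,e_a\rangle$, $\mathbf J_a=\langle\mathbf J,e_a\rangle$. Classical Koszul operators $\partial_i:\bigwedge^i\mathfrak g\otimes C^\infty(M)\to\bigwedge^{i-1}\mathfrak g\otimes C^\infty(M)$, $x\otimes F\mapsto\sum_ai(e^a)x\otimes J_aF$. Quantised: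 $\boldsymbol\partial_1:\mathfrak g\otimes C^\infty(M)[[\lambda]]\to C^\infty(M)[[\lambda]]$, $\boldsymbol\partial_1(\xi\otimes F)=F*\langle\mathbf J,\xi\rangle+i\lambda\chi(\xi)F$. Fix linear maps $\mathrm{prol}:C^\infty(C)\to C^\infty(M)$, $h_i:\bigwedge^i\mathfrak g\otimes C^\infty(M)\to\bigwedge^{i+1}\mathfrak g\otimes C^\infty(M)$ with $\iota^*\mathrm{prol}=\mathrm{id}$, $\mathrm{prol}\,\iota^*+\partial_1h_0=\mathrm{id}$, $h_{i-1}\partial_i+\partial_{i+1}h_i=\mathrm{id}$ ($i\ge1$), $h_0\,\mathrm{prol}=0$ (such maps exist), extended $\mathbb C[[\lambda]]$-linearly. Put $B_1=\frac1\lambda(\partial_1-\boldsymbol\partial_1)$, $\boldsymbol\iota^*=\iota^*(\mathrm{id}-\lambda B_1h_0)^{-1}:C^\infty(M)[[\lambda]]\to C^\infty(C)[[\lambda]]$. Then $\boldsymbol\varrho_C(\xi)=\boldsymbol\iota^*\boldsymbol\varrho_M(\xi)\mathrm{prol}$ is a representation of $\mathfrak g$ on $C^\infty(C)[[\lambda]]$, and $\mathbf H^\bullet_{\mathrm{CE}}(\mathfrak g,C^\infty(C)[[\lambda]])$ is its Chevalley-Eilenberg cohomology; $\mathbf H^0_{\mathrm{CE}}=\{u\in C^\infty(C)[[\lambda]]:\boldsymbol\varrho_C(\xi)u=0\ \forall\xi\in\mathfrak g\}$. Deformation of a subspace. For a subspace $W\subset V$ of a vector space, a $\mathbb C[[\lambda]]$-submodule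 $\mathbf W\subset V[[\lambda]]$ is a deformation of $W$ if there is a formal series of linear maps $\mathbf E=\sum_{r\ge0}\lambda^r\mathbf E_r:W[[\lambda]]\to V[[\lambda]]$ with $\mathbf E_0$ the inclusion and $\mathbf E(W[[\lambda]])=\mathbf W$. *)

(* Defs.v *)
From HB Require Import structures.
From mathcomp Require Import all_boot all_order all_algebra.
From mathcomp Require Import all_classical all_reals all_analysis.
From mathcomp Require Import complex.
Set Implicit Arguments.
Unset Strict Implicit.
Unset Printing Implicit Defensive.
Import Order.TTheory GRing.Theory Num.Theory numFieldNormedType.Exports.
Local Open Scope classical_set_scope.
Local Open Scope ring_scope.
Local Open Scope complex_scope.

Section Calculus.
Context {R : realType}.

Fixpoint pd {d} (s : seq 'I_d) (f : 'rV[R]_d -> R) : 'rV[R]_d -> R :=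
  if s is i :: s' then fun x => 'D_(delta_mx 0 i) (pd s' f) x else f.

(* On an open U this is C^infty: a differentiable function is continuous, and
   a function with continuous partial derivatives is differentiable. *)
Definition smooth_on {d} (U : set 'rV[R]_d) (f : 'rV[R]_d -> R) :=
  forall s x, U x -> differentiable (pd s f) x.

Lemma near_eq_differentiable (V W : normedModType R) (f g : V -> W) (x : V) :
  (\near x, f x = g x) -> differentiable f x -> differentiable g x.
Proof.
move=> fg df; have fgx : f x = g x by apply: nbhs_singleton fg.
apply/diff_locallyP.
have /diff_locallyP [c E] := df.
have dfg : 'd g x = 'd f x :> (V -> W).
  apply: diff_unique; first exact: c.
  apply/eqaddoP => e e0.
  have /eqaddoP /(_ _ e0) := E.
  move: fg; rewrite (near_shift 0) /= => fg.
  apply: filterS2 fg => h /=.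
  by rewrite subr0 /shift /= !fctE /= -!fgx => ->.
rewrite dfg; split=> //.
apply/eqaddoP => e e0.
have /eqaddoP /(_ _ e0) := E.
move: fg; rewrite (near_shift 0) /= => fg.
apply: filterS2 fg => h /=.
by rewrite subr0 /shift /= !fctE /= -!fgx => ->.
Qed.

Section fixdim.
Context {d : nat}.
Implicit Types (U : set 'rV[R]_d) (f g : 'rV[R]_d -> R).

Lemma pd_rcons s i f : pd (rcons s i) f = pd s (pd [:: i] f).
Proof. by elim: s => //= j s ->. Qed.

Lemma eq_pd U f g : open U -> {in U, f =1 g} ->
  forall s, {in U, pd s f =1 pd s g}.
Proof.
move=> oU fg; elim=> [|i s IH] //= x /set_mem Ux.
apply: near_eq_derive.
have := open_nbhs_nbhs (conj oU Ux).
by apply: filterS => y Uy; apply: IH; exact: mem_set.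
Qed.

Definition smoothn k U f :=
  forall s x, (size s <= k)%N -> U x -> differentiable (pd s f) x.

Lemma smooth_onP U f : smooth_on U f <-> forall k, smoothn k U f.
Proof.
split=> [h k s x _|h s x]; first exact: h.
exact: (h (size s)).
Qed.

Lemma smoothnS k U f : smoothn k.+1 U f <->
  smoothn 0 U f /\ forall i, smoothn k U (pd [:: i] f).
Proof.
split=> [h|[h0 h] s x].
  split=> [s x|i s x sk Ux].
    by case: s => // _ Ux; exact: (h [::]).
  by rewrite -pd_rcons; apply: h => //; rewrite size_rcons.
case/lastP: s => [_|s i]; first exact: (h0 [::]).
by rewrite size_rcons pd_rcons => sk Ux; exact: h.
Qed.

Lemma smoothnW k U f : smoothn k.+1 U f -> smoothn k U f.
Proof. by move=> h s x sk; apply: h; exact: leqW. Qed.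

Lemma smoothn_eq k U f g : open U -> {in U, f =1 g} ->
  smoothn k U f -> smoothn k U g.
Proof.
move=> oU fg h s x sk Ux; apply: near_eq_differentiable (h s x sk Ux).
have := open_nbhs_nbhs (conj oU Ux).
by apply: filterS => y Uy; apply: (eq_pd oU fg); exact: mem_set.
Qed.

Lemma smoothn0 U f : smoothn 0 U f <-> forall x, U x -> differentiable f x.
Proof.
by split=> [h x|h [] // x _ Ux]; [exact: (h [::])|exact: h].
Qed.

Lemma pd1E i f x : pd [:: i] f x = 'D_(delta_mx 0 i) f x. Proof. by []. Qed.

Lemma smoothn_cst k U c : smoothn k U (cst c).
Proof.
elim: k c => [|k IH] c.
  by apply/smoothn0 => x _; exact: differentiable_cst.
apply/smoothnS; split=> [|i].
  by apply/smoothn0 => x _; exact: differentiable_cst.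
suff -> : pd [:: i] (cst c) = cst 0 by [].
by apply/funext => x; rewrite pd1E derive_cst.
Qed.

Lemma smoothn_add k U f g : open U ->
  smoothn k U f -> smoothn k U g -> smoothn k U (f + g).
Proof.
move=> oU; elim: k f g => [|k IH] f g.
  move=> /smoothn0 hf /smoothn0 hg; apply/smoothn0 => x Ux.
  by apply: differentiableD; [exact: hf|exact: hg].
move=> /smoothnS[/smoothn0 hf hf'] /smoothnS[/smoothn0 hg hg'].
apply/smoothnS; split=> [|i].
  apply/smoothn0 => x Ux.
  by apply: differentiableD; [exact: hf|exact: hg].
apply: smoothn_eq (IH _ _ (hf' i) (hg' i)) => // x /set_mem Ux.
rewrite fctE !pd1E deriveD //; apply: diff_derivable; [exact: hf|exact: hg].
Qed.

Lemma smoothn_mul k U f g : open U ->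
  smoothn k U f -> smoothn k U g -> smoothn k U (f * g).
Proof.
move=> oU; elim: k f g => [|k IH] f g.
  move=> /smoothn0 hf /smoothn0 hg; apply/smoothn0 => x Ux.
  by apply: differentiableM; [exact: hf|exact: hg].
move=> Hf Hg.
have /smoothnS[/smoothn0 hf hf'] := Hf; have /smoothnS[/smoothn0 hg hg'] := Hg.
apply/smoothnS; split=> [|i].
  apply/smoothn0 => x Ux.
  by apply: differentiableM; [exact: hf|exact: hg].
have := smoothn_add oU (IH _ _ (smoothnW Hf) (hg' i))
  (IH _ _ (smoothnW Hg) (hf' i)).
apply: smoothn_eq => // x /set_mem Ux.
rewrite !fctE !pd1E deriveM //; apply: diff_derivable; [exact: hf|exact: hg].
Qed.

Lemma smoothn_sum k U n (F : 'I_n -> 'rV[R]_d -> R) : open U ->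
  (forall j, smoothn k U (F j)) -> smoothn k U (\sum_j F j).
Proof.
move=> oU h; apply: (big_ind (smoothn k U)) => [|f g|j _].
- exact: smoothn_cst.
- exact: smoothn_add.
- exact: h.
Qed.

End fixdim.

Lemma differentiable_rV {d n} (G : 'rV[R]_d -> 'rV[R]_n) x :
  (forall j, differentiable (fun y => G y 0 j) x) -> differentiable G x.
Proof.
move=> h.
have -> : G = \sum_j (fun y => G y 0 j *: delta_mx 0 j).
  apply/funext => y; rewrite fct_sumE [LHS]row_sum_delta //.
apply: differentiable_sum => j; exact: differentiableZl.
Qed.

Lemma pd1_comp {d n} (f : 'rV[R]_n -> R) (G : 'rV[R]_d -> 'rV[R]_n) i x :
  (forall j, differentiable (fun y => G y 0 j) x) ->
  differentiable f (G x) ->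
  pd [:: i] (f \o G) x =
    \sum_j pd [:: j] f (G x) * pd [:: i] (fun y => G y 0 j) x.
Proof.
move=> hG hf; have dG := differentiable_rV hG.
rewrite pd1E deriveE; last exact: differentiable_comp.
rewrite diff_comp //= -[X in 'd f _ X]deriveE //.
rewrite derive_mx; last exact: diff_derivable.
set w := \matrix_(_, _) _.
rewrite [w in LHS]row_sum_delta linear_sum; apply: eq_bigr => j _.
by rewrite linearZ /= -deriveE // mulrC /w mxE.
Qed.

Lemma smoothn_comp {d n} k (U : set 'rV[R]_d) (V : set 'rV[R]_n)
    (f : 'rV[R]_n -> R) (G : 'rV[R]_d -> 'rV[R]_n) :
  open U -> (forall x, U x -> V (G x)) -> smooth_on V f ->
  (forall j, smooth_on U (fun x => G x 0 j)) -> smoothn k U (f \o G).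
Proof.
move=> oU GUV + hG.
have d0 h : smooth_on V h -> smoothn 0 U (h \o G).
  move=> hf; apply/smoothn0 => x Ux; apply: differentiable_comp.
    by apply: differentiable_rV => j; exact: (hG j [::]).
  exact: (hf [::] _ (GUV _ Ux)).
elim: k f => [|k IH] f hf; first exact: d0.
apply/smoothnS; split=> [|i]; first exact: d0.
have hf' j : smooth_on V (pd [:: j] f) by move=> s x; rewrite -pd_rcons; exact: hf.
have hG' j : smoothn k U (pd [:: i] (fun y => G y 0 j)).
  by move=> s x _; rewrite -pd_rcons; exact: hG.
have := smoothn_sum oU (fun j => smoothn_mul oU (IH _ (hf' j)) (hG' j)).
apply: smoothn_eq => // x /set_mem Ux; rewrite pd1_comp.
- by rewrite fct_sumE.
- by move=> j; exact: (hG j [::]).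
- exact: (hf [::] _ (GUV _ Ux)).
Qed.

Section smooth_on_lemmas.
Context {d : nat} (U : set 'rV[R]_d) (oU : open U).
Implicit Types f g : 'rV[R]_d -> R.

Lemma smooth_on_cst c : smooth_on U (cst c).
Proof. by apply/smooth_onP => k; exact: smoothn_cst. Qed.

Lemma smooth_on_add f g : smooth_on U f -> smooth_on U g -> smooth_on U (f + g).
Proof.
by move=> /smooth_onP hf /smooth_onP hg; apply/smooth_onP => k; exact: smoothn_add.
Qed.

Lemma smooth_on_mul f g : smooth_on U f -> smooth_on U g -> smooth_on U (f * g).
Proof.
by move=> /smooth_onP hf /smooth_onP hg; apply/smooth_onP => k; exact: smoothn_mul.
Qed.

Lemma smooth_on_opp f : smooth_on U f -> smooth_on U (- f).
Proof.
move=> hf; have -> : - f = cst (-1) * f.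
  by apply/funext => x; rewrite !fctE mulN1r.
exact: smooth_on_mul (smooth_on_cst _) hf.
Qed.

Lemma smooth_on_comp {n} (V : set 'rV[R]_n) (f : 'rV[R]_n -> R)
    (G : 'rV[R]_d -> 'rV[R]_n) :
  (forall x, U x -> V (G x)) -> smooth_on V f ->
  (forall j, smooth_on U (fun x => G x 0 j)) -> smooth_on U (f \o G).
Proof.
by move=> GUV hf hG; apply/smooth_onP => k; exact: (smoothn_comp oU GUV hf hG).
Qed.

Lemma smooth_on_local f :
  (forall x, U x -> exists V g,
     [/\ open V, V x, smooth_on V g & {in V, f =1 g}]) -> smooth_on U f.
Proof.
move=> h s x /h [V [g [oV Vx sg fg]]].
apply: near_eq_differentiable (sg s x Vx).
have := open_nbhs_nbhs (conj oV Vx).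
by apply: filterS => y Vy; apply/esym/(eq_pd oV fg)/mem_set.
Qed.

End smooth_on_lemmas.

Definition csmooth_on {d} (U : set 'rV[R]_d) (f : 'rV[R]_d -> R[i]) :=
  smooth_on U (fun x => complex.Re (f x)) /\
  smooth_on U (fun x => complex.Im (f x)).

Definition cpd {d} (s : seq 'I_d) (f : 'rV[R]_d -> R[i]) (x : 'rV[R]_d) : R[i] :=
  pd s (fun y => complex.Re (f y)) x +i* pd s (fun y => complex.Im (f y)) x.

End Calculus.

(* A chart with domain [cdom]; [cmap] and [cinv] are only meaningful on [cdom]
   and on its image. *)
Record chart (R : realType) (d : nat) (M : topologicalType) := Chart {
  cdom : set M;
  cmap : M -> 'rV[R]_d;
  cinv : 'rV[R]_d -> M;
  cdom_open : open cdom;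
  cimg_open : open (cmap @` cdom);
  cmapK : forall p, cdom p -> cinv (cmap p) = p;
  cmap_cts : forall p, cdom p -> {for p, continuous cmap};
  cinv_cts : forall p, cdom p -> {for cmap p, continuous cinv} }.

Arguments cdom_open {R d M} c.
Arguments cimg_open {R d M} c.

(* Smooth manifold of dimension d (Hausdorff, second countable, not
   necessarily connected).  The preferred chart [chart_at p] around p is used
   to write tangent vectors at p as row vectors of components. *)
Record manifold (R : realType) (d : nat) := Manifold {
  carrier :> topologicalType;
  atlas : set (chart R d carrier);
  chart_at : carrier -> chart R d carrier;
  manifold_hausdorff : hausdorff_space carrier;
  manifold_second_countable : @second_countable carrier;
  chart_at_atlas : forall p, atlas (chart_at p);
  chart_at_dom : forall p, cdom (chart_at p) p;
  atlas_compatible : forall phi psi, atlas phi -> atlas psi ->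
    forall j, smooth_on (cmap phi @` (cdom phi `&` cdom psi))
                (fun x => cmap psi (cinv phi x) 0 j) }.

Section SmoothFunctions.
Context {R : realType} {d : nat}.
Implicit Types M : manifold R d.

Definition smooth_fun M (f : M -> R[i]) :=
  forall phi, atlas phi -> csmooth_on (cmap phi @` cdom phi) (f \o cinv phi).

Definition smooth_pred M : {pred M -> R[i]} := [pred f | `[< smooth_fun f >]].
Arguments smooth_pred M : clear implicits.

Lemma smooth_subring M : subring_closed (smooth_pred M).
Proof.
have oI (phi : chart R d M) := cimg_open phi.
split=> [|f g /asboolP hf /asboolP hg|f g /asboolP hf /asboolP hg];
  apply/asboolP => phi aphi.
- by split; exact: smooth_on_cst.
- have [fr fi] := hf _ aphi; have [gr gi] := hg _ aphi; split.
  + have := smooth_on_add (oI phi) fr (smooth_on_opp (oI phi) gr).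
    by congr smooth_on; apply/funext => x; rewrite !fctE /= raddfB.
  + have := smooth_on_add (oI phi) fi (smooth_on_opp (oI phi) gi).
    by congr smooth_on; apply/funext => x; rewrite !fctE /= raddfB.
- have [fr fi] := hf _ aphi; have [gr gi] := hg _ aphi; split.
  + have := smooth_on_add (oI phi) (smooth_on_mul (oI phi) fr gr)
      (smooth_on_opp (oI phi) (smooth_on_mul (oI phi) fi gi)).
    congr smooth_on; apply/funext => x; rewrite !fctE /=.
    by case: (f _) (g _) => a b [a' b'].
  + have := smooth_on_add (oI phi) (smooth_on_mul (oI phi) fr gi)
      (smooth_on_mul (oI phi) fi gr).
    congr smooth_on; apply/funext => x; rewrite !fctE /=.
    by case: (f _) (g _) => a b [a' b'].
Qed.

Lemma smooth_scale M : GRing.scaler_closed (smooth_pred M).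
Proof.
move=> a f hf; have -> : a *: f = cst a * f by apply/funext => x; rewrite !fctE.
have [h1 hB hM] := smooth_subring M; apply: hM => //.
by apply/asboolP => phi aphi; split; exact: smooth_on_cst.
Qed.

HB.instance Definition _ M :=
  GRing.isSubringClosed.Build (M -> R[i]) (smooth_pred M) (smooth_subring M).
HB.instance Definition _ M :=
  GRing.isScaleClosed.Build R[i] (M -> R[i]) (smooth_pred M) (@smooth_scale M).

(* C^infty(M), complex-valued. *)
Record Cinf M := MkCinf { cfun :> M -> R[i]; cfun_smooth : cfun \in smooth_pred M }.

HB.instance Definition _ M := [isSub for @cfun M].
HB.instance Definition _ M := [Choice of Cinf M by <:].
HB.instance Definition _ M :=
  GRing.SubChoice_isSubComPzRing.Build _ _ (Cinf M) (smooth_subring M).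
HB.instance Definition _ M := [SubZmodule_isSubLmodule of Cinf M by <:].

Definition mkCinf M (f : M -> R[i]) (hf : smooth_fun f) : Cinf M :=
  MkCinf (asboolT hf : f \in smooth_pred M).

(* Partial derivatives of functions on M in the coordinates of a chart. *)
Definition coordD M (phi : chart R d M) (s : seq 'I_d) (f : M -> R[i]) (p : M) :
    R[i] :=
  cpd s (f \o cinv phi) (cmap phi p).

Definition rcoordD M (phi : chart R d M) (s : seq 'I_d) (f : M -> R) (p : M) : R :=
  pd s (f \o cinv phi) (cmap phi p).

(* Bidifferential operators of finite order, written in every chart as
   (f, g) |-> \sum_(s, t) c_(s, t) * D_s f * D_t g over words s, t of
   coordinate indices of length at most k. *)
Definition bidifferential M (B : Cinf M -> Cinf M -> Cinf M) :=
  exists k : nat, forall phi, atlas phi ->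
  exists c : {bseq k of 'I_d} -> {bseq k of 'I_d} -> M -> R[i],
    (forall s t, csmooth_on (cmap phi @` cdom phi) (c s t \o cinv phi)) /\
    forall (f g : Cinf M) p, cdom phi p ->
      B f g p = \sum_(s : {bseq k of 'I_d}) \sum_(t : {bseq k of 'I_d})
                  c s t p * coordD phi s f p * coordD phi t g p.

End SmoothFunctions.

Section SmoothMaps.
Context {R : realType} {m d : nat} (C : manifold R m) (M : manifold R d).

Definition smooth_map (F : C -> M) :=
  continuous F /\
  forall phi psi, atlas phi -> atlas psi ->
  forall j, smooth_on (cmap phi @` (cdom phi `&` F @^-1` cdom psi))
              (fun x => cmap psi (F (cinv phi x)) 0 j).

(* Matrix of the tangent map at c; it acts on row vectors from the right. *)
Definition tangent_mx (F : C -> M) (c : C) : 'M[R]_(m, d) :=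
  \matrix_(i, j)
    rcoordD (chart_at c) [:: i] (fun q => cmap (chart_at (F c)) (F q) 0 j) c.

(* Smooth embedding: an injective immersion which is a homeomorphism onto its
   image. *)
Record embedding := Embedding {
  emb :> C -> M;
  emb_smooth : smooth_map emb;
  emb_inj : injective emb;
  emb_immersion : forall c, row_free (tangent_mx emb c);
  emb_initial : forall U : set C, open U -> exists2 V, open V & U = emb @^-1` V }.

Lemma smooth_fun_comp (F : C -> M) (f : M -> R[i]) :
  smooth_map F -> smooth_fun f -> smooth_fun (f \o F).
Proof.
move=> [cF sF] sf phi aphi.
have oI := cimg_open phi.
have key (h : R[i] -> R) :
    (forall psi, atlas psi ->
       smooth_on (cmap psi @` cdom psi) (fun x => h (f (cinv psi x)))) ->
    smooth_on (cmap phi @` cdom phi) (fun x => h (f (F (cinv phi x)))).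
  move=> hf; apply: smooth_on_local => _ [c dc <-].
  pose psi := chart_at (F c).
  have apsi : atlas psi by exact: chart_at_atlas.
  pose W := cmap phi @` (cdom phi `&` F @^-1` cdom psi).
  have WE : W = cmap phi @` cdom phi `&` cinv phi @^-1` (F @^-1` cdom psi).
    rewrite eqEsubset; split=> [_ [q [dq Fq] <-]|_ [[q dq <-]]].
      by split; [exists q|rewrite /preimage /= cmapK].
    by rewrite /preimage /= cmapK // => Fq; exists q.
  have oW : open W.
    rewrite openE WE => _ [[q dq <-] Fq]; apply: filterI.
      by apply: open_nbhs_nbhs; split=> //; exists q.
    apply: cinv_cts => //.
    apply: open_nbhs_nbhs; split=> //.
    apply: open_comp; last exact: cdom_open.
    by move=> x _; exact: cF.
  exists W, ((fun x => h (f (cinv psi x))) \o (fun x => cmap psi (F (cinv phi x)))).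
  split=> //.
  - by exists c => //; split=> //; exact: chart_at_dom.
  - apply: (smooth_on_comp oW _ (hf _ apsi)).
      by move=> _ [q [dq Fq] <-]; exists (F q) => //; rewrite cmapK.
    by move=> j; exact: sF.
  - by move=> _ /set_mem [q [dq Fq] <-] /=; rewrite !cmapK.
by split; apply: key => psi apsi; have [] := sf _ apsi.
Qed.

Lemma cfunP (f : Cinf M) : smooth_fun f. Proof. exact/asboolP/(cfun_smooth f). Qed.

Definition pullback (F : embedding) (f : Cinf M) : Cinf C :=
  mkCinf (smooth_fun_comp (emb_smooth F) (cfunP f)).

End SmoothMaps.

Section VectorFields.
Context {R : realType} {m : nat} (C : manifold R m).

(* Real vector field: components in the preferred charts, smooth in the sense
   that it maps smooth functions to smooth functions. *)
Record vector_field := VectorField {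
  vf :> C -> 'rV[R]_m;
  vf_smooth : forall u : Cinf C,
    smooth_fun (fun c => \sum_j (vf c 0 j)%:C * coordD (chart_at c) [:: j] u c) }.

Definition vf_act (X : vector_field) (u : Cinf C) : Cinf C :=
  mkCinf (vf_smooth X u).

End VectorFields.

Section Symplectic.
Context {R : realType} {d : nat} (M : manifold R d).

(* Jacobian of the change of coordinates: row i holds the derivatives of the
   psi-coordinates along the i-th phi-coordinate. *)
Definition jacobian_mx (phi psi : chart R d M) (p : M) : 'M[R]_d :=
  \matrix_(i, j) rcoordD phi [:: i] (fun q => cmap psi q 0 j) p.

(* A closed nondegenerate 2-form, given by its component matrices
   omega(d/dx_i, d/dx_j) in all charts of the atlas. *)
Record symplectic_form := SymplecticForm {
  om :> chart R d M -> M -> 'M[R]_d;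
  om_smooth : forall phi, atlas phi ->
    forall i j, smooth_on (cmap phi @` cdom phi) (fun x => om phi (cinv phi x) i j);
  om_tensor : forall phi psi p, atlas phi -> atlas psi -> cdom phi p -> cdom psi p ->
    om phi p = jacobian_mx phi psi p *m om psi p *m (jacobian_mx phi psi p)^T;
  om_skew : forall phi p, atlas phi -> cdom phi p -> (om phi p)^T = - om phi p;
  om_nondegenerate : forall phi p, atlas phi -> cdom phi p -> om phi p \in unitmx;
  om_closed : forall phi p, atlas phi -> cdom phi p -> forall i j k,
    rcoordD phi [:: i] (fun q => om phi q j k) p +
    rcoordD phi [:: j] (fun q => om phi q k i) p +
    rcoordD phi [:: k] (fun q => om phi q i j) p = 0 }.

Variable w : symplectic_form.

(* Complexified component matrix of omega at p in the preferred chart. *)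
Definition om_at (p : M) : 'M[R[i]]_d :=
  map_mx (fun x : R => x%:C) (w (chart_at p) p).

Definition grad (f : M -> R[i]) (p : M) : 'rV[R[i]]_d :=
  \row_j coordD (chart_at p) [:: j] f p.

(* The solution X of X *m om_at p = grad f p, i.e. of omega(X, -) = df. *)
Definition ham_vec (f : M -> R[i]) (p : M) : 'rV[R[i]]_d :=
  grad f p *m invmx (om_at p).

(* {f, g} = omega(X_f, X_g). *)
Definition poisson (f g : M -> R[i]) (p : M) : R[i] :=
  (ham_vec f p *m om_at p *m (ham_vec g p)^T) 0 0.

End Symplectic.

(* V[[lambda]], as coefficient sequences. *)
Notation fps V := (nat -> V).

Section FormalSeries.
Context {R : realType}.

Definition lam_mul {V : nmodType} (F : fps V) : fps V :=
  fun r => if r is r'.+1 then F r' else 0.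

(* 1/lambda, for series without constant term. *)
Definition lam_div {V : nmodType} (F : fps V) : fps V := fun r => F r.+1.

Definition fps_scale {V : lmodType R[i]} (a : fps R[i]) (F : fps V) : fps V :=
  fun r => \sum_(k < r.+1) a k *: F (r - k)%N.

Definition fps_submodule {V : lmodType R[i]} (W : set (fps V)) :=
  W 0 /\ forall a F G, W F -> W G -> W (fps_scale a F + G).

Definition linear_over {V : lmodType R[i]} (W : set V) (E : V -> V) :=
  forall a u v, W u -> W v -> E (a *: u + v) = a *: E u + E v.

(* The C[[lambda]]-linear extension of a formal series of linear maps. *)
Definition fps_apply {V : lmodType R[i]} (E : nat -> V -> V) (F : fps V) : fps V :=
  fun r => \sum_(k < r.+1) E k (F (r - k)%N).

Definition is_deformation {V : lmodType R[i]} (W : set V) (WW : set (fps V)) :=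
  fps_submodule WW /\
  exists E : nat -> V -> V,
    [/\ forall r, linear_over W (E r),
        forall u, W u -> E 0%N u = u &
        WW = [set fps_apply E F | F in [set F : fps V | forall r, W (F r)]]].

End FormalSeries.

Section StarProduct.
Context {R : realType} {d : nat} (M : manifold R d) (w : symplectic_form M).

Definition star_of (B : nat -> Cinf M -> Cinf M -> Cinf M) (F G : fps (Cinf M)) :
    fps (Cinf M) :=
  fun r => \sum_(k < r.+1) \sum_(l < (r - k).+1) B k (F l) (G (r - k - l)%N).

Record star_product := StarProduct {
  star_coef : nat -> Cinf M -> Cinf M -> Cinf M;
  star_bidifferential : forall r, bidifferential (star_coef r);
  star_assoc : associative (star_of star_coef);
  star_coef0 : forall f g, star_coef 0 f g = f * g;
  star_coef1 : forall (f g : Cinf M) p,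
    star_coef 1 f g p - star_coef 1 g f p = 'i * poisson w f g p;
  star_unit : forall r f, star_coef r.+1 1 f = 0 /\ star_coef r.+1 f 1 = 0 }.

Definition star (S : star_product) := star_of (star_coef S).

Definition star_comm (S : star_product) (F G : fps (Cinf M)) :=
  star S F G - star S G F.

End StarProduct.

Record lie_algebra (R : realType) := LieAlgebra {
  lie_sort :> vectType R;
  lie : lie_sort -> lie_sort -> lie_sort;
  lie_linear : forall x, linear (lie x);
  lie_alternating : forall x, lie x x = 0;
  lie_jacobi : forall x y z,
    lie x (lie y z) + lie y (lie z x) + lie z (lie x y) = 0 }.

Section MomentumMaps.
Context {R : realType} {d : nat} (M : manifold R d) (g : lie_algebra R).

(* Smooth maps M -> g^*. *)
Record dual_map := DualMap {
  dmap :> M -> 'Hom(g, R^o);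
  dmap_smooth : forall xi, smooth_fun (fun p => (dmap p xi : R)%:C) }.

Definition pairing (J : dual_map) (xi : g) : Cinf M := mkCinf (dmap_smooth J xi).

Definition qpairing (JJ : fps dual_map) (xi : g) : fps (Cinf M) :=
  fun r => pairing (JJ r) xi.

Definition classical_momentum_map (w : symplectic_form M) (J : dual_map) :=
  forall xi eta p,
    poisson w (pairing J xi) (pairing J eta) p = pairing J (lie xi eta) p.

Definition quantum_momentum_map (w : symplectic_form M) (S : star_product w)
    (JJ : fps dual_map) :=
  classical_momentum_map w (JJ 0%N) /\
  forall xi eta, star_comm S (qpairing JJ xi) (qpairing JJ eta) =
                 lam_mul ('i *: qpairing JJ (lie xi eta)).

(* Surjectivity of the tangent map T_p M -> g^* at all points over mu. *)
Definition regular_value (J : dual_map) (mu : 'Hom(g, R^o)) :=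
  forall p, J p = mu -> forall nu : 'Hom(g, R^o), exists v : 'rV[R]_d,
    forall xi, \sum_j v 0 j * rcoordD (chart_at p) [:: j] (fun q => J q xi) p
               = nu xi.

(* C is J^-1(0) with its structure of embedded submanifold, which is unique:
   iota is an embedding with that image. *)
Definition regular_constraint_surface {m} (J : dual_map) (C : manifold R m)
    (iota : embedding C M) :=
  [/\ regular_value J 0, range iota = [set p | J p = 0] & [set: C] !=set0].

(* xi_C is the restriction of the Hamiltonian vector field of <J, xi>:
   T iota o xi_C = X_<J, xi> o iota. *)
Definition restricted_action {m} (w : symplectic_form M) (J : dual_map)
    (C : manifold R m) (iota : embedding C M) (xiC : g -> vector_field C) :=
  forall xi c, map_mx (fun x : R => x%:C) (xiC xi c *m tangent_mx iota c) =
               ham_vec w (pairing J xi) (iota c).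

Definition classical_rep {m} (C : manifold R m) (xiC : g -> vector_field C)
    (xi : g) (u : Cinf C) : Cinf C := - vf_act (xiC xi) u.

End MomentumMaps.

(* The exterior algebra on e_1, ..., e_n (or on the dual basis) tensored with V;
   the coefficient at S = {a_1 < ... < a_k} is that of e_a1 /\ ... /\ e_ak. *)
Notation ext n V := {ffun {set 'I_n} -> V}.

Section Exterior.
Context {R : realType} {n : nat} {V : lmodType R[i]}.
Implicit Types (a : 'I_n) (S : {set 'I_n}) (x : ext n V).

Definition ext_sign a S : R[i] := (-1) ^+ #|[set b in S | (b < a)%N]|.

Definition ext_wedge a x : ext n V :=
  [ffun S : {set 'I_n} => if a \in S then ext_sign a S *: x (S :\ a) else 0].

Definition ext_contr a x : ext n V :=
  [ffun S : {set 'I_n} => if a \in S then 0 else ext_sign a S *: x (a |: S)].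

Definition ext_degree k x := forall S, #|S| != k -> x S = 0.

Definition ext0 (v : V) : ext n V := [ffun S : {set 'I_n} => if S == finset.set0 then v else 0].

End Exterior.

Section ChevalleyEilenberg.
Context {R : realType} {n : nat} (g : lie_algebra R) (e : n.-tuple g).

(* [struct_const c a b] is f^c_(ab). *)
Definition struct_const (c a b : 'I_n) : R := coord e c (lie e`_a e`_b).

(* chi = (1/2) tr ad. *)
Definition half_trace_ad (xi : g) : R := 2^-1 * \sum_a coord e a (lie xi e`_a).

Context {Q : lmodType R[i]} (rho : g -> Q -> Q).

Definition CE_diff (x : ext n Q) : ext n Q :=
  - (2^-1 *: \sum_a \sum_b \sum_c (struct_const c a b)%:C *:
       ext_wedge a (ext_wedge b (ext_contr c x)))
  + \sum_(a < n) ext_wedge a [ffun S : {set 'I_n} => rho e`_a (x S)].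

(* H^(k+1) = 0 *)
Definition CE_vanishesS (k : nat) :=
  forall x, ext_degree k.+1 x -> CE_diff x = 0 ->
  exists2 y, ext_degree k y & CE_diff y = x.

Definition CE_H0 : set Q := [set u | forall xi, rho xi u = 0].

End ChevalleyEilenberg.

Section Reduction.
Context {R : realType} {d m n : nat} {M : manifold R d} {w : symplectic_form M}
  (S : star_product w) {g : lie_algebra R} (e : n.-tuple g)
  (JJ : fps (dual_map M g)) {C : manifold R m} (iota : embedding C M).

Definition koszul (x : ext n (Cinf M)) : ext n (Cinf M) :=
  \sum_(a < n) [ffun T => pairing (JJ 0%N) e`_a * ext_contr a x T].

(* The maps h_i are the restrictions of h to degree i. *)
Definition koszul_homotopy (prol : {linear Cinf C -> Cinf M})
    (h : {linear ext n (Cinf M) -> ext n (Cinf M)}) :=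
  [/\ forall i x, ext_degree i x -> ext_degree i.+1 (h x),
      forall u, pullback iota (prol u) = u,
      forall f, prol (pullback iota f) + koszul (h (ext0 f)) finset.set0 = f,
      forall i x, (0 < i)%N -> ext_degree i x -> h (koszul x) + koszul (h x) = x &
      forall u, h (ext0 (prol u)) = 0].

Variables (prol : {linear Cinf C -> Cinf M})
  (h : {linear ext n (Cinf M) -> ext n (Cinf M)}).

Definition koszul1 (x : fps (ext n (Cinf M))) : fps (Cinf M) :=
  fun r => koszul (x r) finset.set0.

Definition qkoszul1 (x : fps (ext n (Cinf M))) : fps (Cinf M) :=
  \sum_(a < n)
    (star S (fun r => x r [set a]%SET) (qpairing JJ e`_a)
     + lam_mul (('i * (half_trace_ad e e`_a)%:C) *: (fun r => x r [set a]%SET))).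

Definition B1 (x : fps (ext n (Cinf M))) : fps (Cinf M) :=
  lam_div (koszul1 x - qkoszul1 x).

Definition h0 (F : fps (Cinf M)) : fps (ext n (Cinf M)) := fun r => h (ext0 (F r)).

(* iota^* (id - lambda B1 h0)^-1.  The operator id - lambda B1 h0 is bijective
   because lambda B1 h0 raises the order in lambda, so xget picks the unique
   preimage. *)
Definition qpullback (F : fps (Cinf M)) : fps (Cinf C) :=
  pullback iota \o
    xget 0 [set G : fps (Cinf M) | G - lam_mul (B1 (h0 G)) = F].

Definition qrepM (xi : g) (F : fps (Cinf M)) : fps (Cinf M) :=
  'i^-1 *: lam_div (star_comm S (qpairing JJ xi) F).

Definition qrepC (xi : g) (u : fps (Cinf C)) : fps (Cinf C) :=
  qpullback (qrepM xi (prol \o u)).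

End Reduction.

(* Main.v *)
(* The quantum representation on C^infty(C)[[lambda]] deforms the classical one.
   It is a representation because the kernel of the quantum restriction map is
   the image of the quantum Koszul operator, which the quantum representation on
   C^infty(M)[[lambda]] preserves; that the restriction map kills this image
   follows, order by order in lambda, from the exactness of the classical Koszul
   complex in degree one, whose boundaries lift to quantum ones.  The obstruction
   to extending a classical invariant by one more order in lambda is then a
   classical 1-cocycle, hence a coboundary; a linear section of the coboundary map
   makes the extension linear. *)
From HB Require Import structures.
Require Import Defs.
From mathcomp Require Import all_boot all_order all_algebra.
From mathcomp Require Import all_classical all_reals all_analysis.
From mathcomp Require Import complex ring.
Set Implicit Arguments.
Unset Strict Implicit.
Unset Printing Implicit Defensive.
Import Order.TTheory GRing.Theory Num.Theory numFieldNormedType.Exports.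
Local Open Scope classical_set_scope.
Local Open Scope ring_scope.
Local Open Scope complex_scope.

(** Let T be the quantum representation on C^infty(C)[[lambda]], rho its order 0 and lambda T' = T -
    rho. Invariance of u reads rho(e_a) u_(r+1) = - T'_a(u)_r. Choosing u_(r+1) linearly needs a
    right inverse [s] of v |-> (rho(e_a) v)_a on its image. The maps E_r only have to be linear, so
    an algebraic complement given by Zorn's lemma is enough. It makes [s] total, hence usable before
    the obstruction is known to be a coboundary. The recursion becomes A u = F with A = id + lambda
    s T', and E is the inverse of A: A carries quantum invariants to series of classical ones, and
    the vanishing of H^1 gives the converse for E. On the Koszul side only the differentials out of
    degrees one and two are quantised. Right star multiplications by the momentum map commute only
    up to order lambda, which forces the term with structure constants in [qkos2]; the shift by chi
    fits in because chi vanishes on brackets. *)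

(** * Linear algebra over formal power series *)

Section LamLinear.
Context {R : realType}.
Implicit Types U V W : lmodType R[i].

(* These two conditions amount to C[[lambda]]-linearity, by [lam_fps_scale]. *)
Definition lam_linear V W (T : fps V -> fps W) :=
  (forall a F G, T (a *: F + G) = a *: T F + T G) /\
  forall F, T (lam_mul F) = lam_mul (T F).

Definition fps_const V (v : V) : fps V := fun r => if r is 0 then v else 0.

(** The same shift as [lam_div], but meant also for series with a constant term. *)
Definition fps_tail V (F : fps V) : fps V := fun r => F r.+1.

Section arith.
Context {V W : lmodType R[i]} {T : fps V -> fps W} (hT : lam_linear T).

Lemma lamZD a F G : T (a *: F + G) = a *: T F + T G. Proof. by case: hT. Qed.

Lemma lamM F : T (lam_mul F) = lam_mul (T F). Proof. by case: hT. Qed.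

Lemma lamD F G : T (F + G) = T F + T G.
Proof. by have := lamZD 1 F G; rewrite !scale1r. Qed.

Lemma lam0 : T 0 = 0.
Proof. by have := lamZD (-1) 0 0; rewrite !scaleN1r oppr0 addr0 addNr. Qed.

Lemma lamZ a F : T (a *: F) = a *: T F.
Proof. by have := lamZD a F 0; rewrite lam0 !addr0. Qed.

Lemma lamN F : T (- F) = - T F.
Proof. by rewrite -scaleN1r lamZ scaleN1r. Qed.

Lemma lamB F G : T (F - G) = T F - T G.
Proof. by rewrite lamD lamN. Qed.

Lemma lam_sum I (r : seq I) (P : pred I) (F : I -> fps V) :
  T (\sum_(i <- r | P i) F i) = \sum_(i <- r | P i) T (F i).
Proof. exact: (big_morph T lamD lam0). Qed.

End arith.

Lemma lam_mul_linear V : lam_linear (@lam_mul V).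
Proof.
by split=> // a F G; apply/funext => -[|r]; rewrite /lam_mul !fctE //= scaler0 addr0.
Qed.

Lemma lam_linear_id V : lam_linear (@id (fps V)).
Proof. by []. Qed.

Section series.
Context {V : lmodType R[i]}.

Lemma lam_mul_div (F : fps V) : F 0%N = 0 -> lam_mul (lam_div F) = F.
Proof. by move=> F0; apply/funext => -[|r]; rewrite /lam_mul /lam_div ?F0. Qed.

Lemma lam_mulK : cancel (@lam_mul V) lam_div.
Proof. by []. Qed.

Lemma lam_mulI : injective (@lam_mul V).
Proof. exact: can_inj lam_mulK. Qed.

Lemma lam_divZD a (F G : fps V) :
  lam_div (a *: F + G) = a *: lam_div F + lam_div G.
Proof. by []. Qed.

Lemma fps_split (F : fps V) : F = fps_const (F 0%N) + lam_mul (fps_tail F).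
Proof. by apply/funext => -[|r]; rewrite !fctE /= ?addr0 ?add0r. Qed.

End series.

Section constructions.
Context {V W : lmodType R[i]}.

Lemma lam_linear_comp {U} (T : fps V -> fps W) (T' : fps U -> fps V) :
  lam_linear T -> lam_linear T' -> lam_linear (fun F => T (T' F)).
Proof.
move=> hT hT'; split=> [a F G|F]; first by rewrite (lamZD hT') (lamZD hT).
by rewrite (lamM hT') (lamM hT).
Qed.

Lemma lam_linear_add (T T' : fps V -> fps W) :
  lam_linear T -> lam_linear T' -> lam_linear (fun F => T F + T' F).
Proof.
move=> hT hT'; split=> [a F G|F].
  by rewrite (lamZD hT') (lamZD hT) scalerDr addrACA.
by rewrite (lamM hT') (lamM hT) (lamD (lam_mul_linear _)).
Qed.

Lemma lam_linear_scale a (T : fps V -> fps W) :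
  lam_linear T -> lam_linear (fun F => a *: T F).
Proof.
move=> hT; split=> [b F G|F].
  by rewrite (lamZD hT) scalerDr !scalerA mulrC.
by rewrite (lamM hT) (lamZ (lam_mul_linear _)).
Qed.

Lemma lam_linear_sub (T T' : fps V -> fps W) :
  lam_linear T -> lam_linear T' -> lam_linear (fun F => T F - T' F).
Proof.
move=> hT hT'.
have := lam_linear_add hT (lam_linear_scale (-1) hT').
by congr lam_linear; apply/funext => F; rewrite scaleN1r.
Qed.

Lemma lam_linear_sum n (T : 'I_n -> fps V -> fps W) :
  (forall i, lam_linear (T i)) -> lam_linear (fun F => \sum_i T i F).
Proof.
move=> hT; split=> [b F G|F].
  by rewrite scaler_sumr -big_split; apply: eq_bigr => i _; rewrite (lamZD (hT i)).
by rewrite (lam_sum (lam_mul_linear _)); apply: eq_bigr => i _; rewrite (lamM (hT i)).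
Qed.

Lemma lam_linear_map (f : {linear V -> W}) : lam_linear (fun F r => f (F r)).
Proof.
split=> [b F G|F]; first by apply/funext => r; rewrite !fctE linearP.
by apply/funext => -[|r]; rewrite /lam_mul ?linear0.
Qed.

(** Dividing by lambda commutes with multiplying by lambda only on series without constant term,
    hence the first hypothesis. *)
Lemma lam_linear_div (T : fps V -> fps W) :
  (forall F, T F 0%N = 0) -> lam_linear T -> lam_linear (fun F => lam_div (T F)).
Proof.
move=> T0 hT; split=> [b F G|F]; first by rewrite (lamZD hT).
by rewrite (lamM hT) lam_mulK lam_mul_div.
Qed.

Context {T : fps V -> fps W} (hT : lam_linear T).

(** A lambda-linear map is a formal series of linear maps T_k v = T (fps_const v) k, the form that
    [is_deformation] asks for. Continuity is automatic: peeling off constant terms reaches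
    coefficient r after finitely many steps. *)
Lemma lam_linearE F r :
  T F r = \sum_(k < r.+1) T (fps_const (F (r - k)%N)) k.
Proof.
elim: r F => [|r IH] F;
  rewrite {1}[F]fps_split (lamD hT) (lamM hT) fctE.
  by rewrite big_ord1 /= addr0.
rewrite /= IH [RHS]big_ord_recr /= subnn addrC; congr (_ + _).
by apply: eq_bigr => k _; rewrite /fps_tail subSn // -ltnS.
Qed.

Lemma lam_causal r F G : (forall s, (s <= r)%N -> F s = G s) -> T F r = T G r.
Proof.
by move=> FG; rewrite !lam_linearE; apply: eq_bigr => k _; rewrite FG // leq_subr.
Qed.

Lemma fps_scale_split (U : lmodType R[i]) (a : fps R[i]) (F : fps U) :
  fps_scale a F = a 0%N *: F + lam_mul (fps_scale (fps_tail a) F).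
Proof.
apply/funext => -[|r]; rewrite /fps_scale !fctE /=; first by rewrite big_ord1 addr0.
by rewrite big_ord_recl subn0.
Qed.

Lemma lam_fps_scale a F : T (fps_scale a F) = fps_scale a (T F).
Proof.
apply/funext => r; elim: r a => [|r IH] a;
  rewrite [fps_scale a F]fps_scale_split [fps_scale a (T F)]fps_scale_split
    (lamZD hT) (lamM hT) !fctE //=.
by rewrite IH.
Qed.

Lemma lam_const_linear r a u v :
  T (fps_const (a *: u + v)) r = a *: T (fps_const u) r + T (fps_const v) r.
Proof.
rewrite -[RHS]/((a *: T (fps_const u) + T (fps_const v)) r) -(lamZD hT).
congr (T _ _); apply/funext => -[|s] //.
by rewrite !fctE /= scaler0 addr0.
Qed.

End constructions.

Section inverse.
Context {V : lmodType R[i]} {A : fps V -> fps V}.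
Hypotheses (hA : lam_linear A) (A0 : forall F, A F 0%N = F 0%N).

(** An element of the kernel has no constant term, so it is divisible by lambda, and the quotient
    lies in the kernel again. *)
Lemma lam_unipotent_inj : injective A.
Proof.
move=> F G /eqP; rewrite -subr_eq0 -(lamB hA) => /eqP AFG.
apply/eqP; rewrite -subr_eq0; apply/eqP.
move: (F - G) AFG => H AH; apply/funext => r.
elim: r H AH => [|r IH] H AH; first by rewrite -A0 AH.
have HE : H = lam_mul (fps_tail H).
  by rewrite {1}[H]fps_split -A0 AH; apply/funext => -[|s];
    rewrite !fctE /= ?addr0 ?add0r.
rewrite -[LHS]/(fps_tail H r) IH //; apply: lam_mulI.
by rewrite -(lamM hA) -HE AH (lam0 (lam_mul_linear _)).
Qed.

(** With lambda N = id - A, the equation is the fixed-point equation G = F + lambda N G. Each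
    iteration settles one more coefficient, so the diagonal of the iterates is the solution. *)
Lemma lam_unipotent_surj F : exists G, A G = F.
Proof.
pose N (G : fps V) : fps V := lam_div (G - A G).
have hN : lam_linear N.
  apply: lam_linear_div => [G|]; first by rewrite !fctE A0 subrr.
  exact: lam_linear_sub (lam_linear_id _) hA.
have AE G : A G = G - lam_mul (N G).
  by rewrite lam_mul_div ?subKr // !fctE A0 subrr.
pose G_ := fix G_ k := if k is k'.+1 then F + lam_mul (N (G_ k')) else F.
have stepG k s : (s <= k)%N -> G_ k.+1 s = G_ k s.
  elim: k s => [|k IH] s; first by case: s => // _; rewrite /= !fctE /= addr0.
  case: s => [|s] sk; first by rewrite /= !fctE.
  rewrite [LHS]/(F s.+1 + N (G_ k.+1) s) [RHS]/(F s.+1 + N (G_ k) s).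
  by congr (_ + _); apply: (lam_causal hN) => t ts; apply: IH; exact: leq_trans ts _.
have stabG k s : (s <= k)%N -> G_ k s = G_ s s.
  elim: k => [|k IH]; first by case: s.
  by rewrite leq_eqVlt => /predU1P[->//|sk]; rewrite stepG // IH.
pose D : fps V := fun r => G_ r r.
have ND r : N D r = N (G_ r) r.
  by apply: (lam_causal hN) => s sr; rewrite /D stabG.
exists D; rewrite AE; apply/funext => -[|r]; first by rewrite !fctE /= subr0.
have DS : D r.+1 = F r.+1 + N D r by rewrite ND.
by rewrite !fctE DS; exact: addrK.
Qed.

Lemma lam_unipotent_inv : exists B : fps V -> fps V,
  [/\ lam_linear B, cancel A B & cancel B A].
Proof.
have /choice [B AB] := lam_unipotent_surj.
exists B; split=> //; last by move=> F; apply: lam_unipotent_inj.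
split=> [a F G|F]; apply: lam_unipotent_inj.
  by rewrite (lamZD hA) !AB.
by rewrite (lamM hA) !AB.
Qed.

End inverse.
End LamLinear.

(** * Complements and linear sections in arbitrary dimension *)

Section Complements.
Context {K : fieldType}.

Definition subspace {V : lmodType K} (A : set V) :=
  A 0 /\ forall a u v, A u -> A v -> A (a *: u + v).

Lemma subspace_complement (V : lmodType K) (A : set V) : subspace A ->
  exists B : set V, [/\ subspace B, forall v, A v -> B v -> v = 0 &
    forall v, exists2 u, A u & B (v - u)].
Proof.
move=> [A0 AZ].
(* Membership of 0 is left out of [P] because the union of the empty chain is empty; it is recovered
   from maximality. *)
pose P := [set B : set V | (forall a u v, B u -> B v -> B (a *: u + v)) /\
                           (forall v, A v -> B v -> v = 0)].
have [F FP totF|B [[BZ AB] maxB]] := @Zorn_bigcup V P.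
  split=> [a u v [X FX Xu] [Y FY Yv]|v Av [X FX Xv]].
    have [XY|YX] := totF _ _ FX FY.
      by exists Y => //; have [YZ _] := FP _ FY; apply: YZ => //; exact: XY.
    by exists X => //; have [XZ _] := FP _ FX; apply: XZ => //; exact: YX.
  by have [_ XA] := FP _ FX; apply: XA.
have B0 : B 0.
  apply: contrapT => nB0; apply: (maxB (B `|` [set 0])).
    by split=> [|/(_ 0)H]; [left | apply: nB0; apply: H; right].
  split=> [a u v [Bu|->] [Bv|->]|v Av [Bv|->]//]; last exact: AB.
  - by left; exact: BZ.
  - by left; have := BZ (a - 1) _ _ Bu Bu; rewrite scalerBl scale1r subrK addr0.
  - by left; rewrite scaler0 add0r.
  - by right; rewrite scaler0 addr0.
exists B; split=> // v; apply: contrapT => nv.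
have AM a u : A u -> A (a *: u) by move=> Au; have := AZ a _ _ Au A0; rewrite addr0.
have BM a u : B u -> B (a *: u) by move=> Bu; have := BZ a _ _ Bu B0; rewrite addr0.
(* The candidate is B + Kv. If it met A in a vector x with k nonzero, then v - k^-1 x would lie in
   B, against the choice of v outside A + B. *)
apply: (maxB [set u | exists2 k, True & B (u - k *: v)]).
  split=> [u Bu|H]; first by exists 0 => //; rewrite scale0r subr0.
  apply: nv; exists 0 => //; rewrite subr0; apply: H.
  by exists 1 => //; rewrite scale1r subrr.
split=> [a x y [k _ Bx] [l _ By]|x Ax [k _ Bx]].
  exists (a * k + l) => //; have := BZ a _ _ Bx By.
  by congr B; rewrite scalerBr scalerA scalerDl opprD addrACA.
have [k0|k0] := eqVneq k 0.
  by apply: AB => //; move: Bx; rewrite k0 scale0r subr0.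
exfalso; apply: nv; exists (k^-1 *: x); first exact: AM.
have := BM (- k^-1) _ Bx.
by congr B; rewrite scalerBr scalerA !scaleNr mulNr mulVf // scaleN1r opprK addrC.
Qed.

(** The section vanishes on a complement D of the image and takes values in a complement B of the
    kernel. The conditions v in B and y - f v in D determine v, and this uniqueness yields
    linearity. *)
Lemma linear_section (V W : lmodType K) (f : {linear V -> W}) :
  exists s : {linear W -> V}, forall v, f (s (f v)) = f v.
Proof.
have [|B [[B0 BZ] kB BV]] := @subspace_complement V [set v | f v = 0].
  by split=> [|a u v /= fu fv]; rewrite /= ?linear0 // linearP fu fv scaler0 addr0.
have [|D [[D0 DZ] rD DW]] := @subspace_complement W (range f).
  split=> [|a _ _ [u _ <-] [v _ <-]]; first by exists 0; rewrite ?linear0.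
  by exists (a *: u + v) => //; rewrite linearP.
have /choice [s sP] : forall y, exists v, B v /\ D (y - f v).
  move=> y; have [_ [v _ <-] Dv] := DW y; have [u fu Bu] := BV v.
  by exists (v - u); split=> //; rewrite linearB fu subr0.
have sU y v : B v -> D (y - f v) -> s y = v.
  move=> Bv Dv; have [Bs Ds] := sP y.
  have Bsv : B (s y - v) by have := BZ (-1) _ _ Bv Bs; rewrite scaleN1r addrC.
  apply/eqP; rewrite -subr_eq0; apply/eqP; apply: kB => //; apply: rD.
    by exists (s y - v).
  have := DZ (-1) _ _ Ds Dv; congr D.
  by rewrite scaleN1r opprB linearB addrA subrK.
have s_lin : linear s.
  move=> a x y; have [Bx Dx] := sP x; have [By Dy] := sP y.
  apply: sU; first exact: BZ.
  have := DZ a _ _ Dx Dy; congr D.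
  by rewrite linearP scalerBr opprD addrACA.
pose sL : {linear W -> V} :=
  HB.pack s (GRing.isLinear.Build K W V *:%R s s_lin).
exists sL => v; have [Bs Ds] := sP (f v).
rewrite /sL /=; apply/esym/eqP; rewrite -subr_eq0; apply/eqP; apply: rD => //.
by exists (v - s (f v)) => //; rewrite linearB.
Qed.

End Complements.

(** * The Chevalley-Eilenberg differential in degrees zero and one *)

Section ChevalleyEilenbergDegreeOne.
Context {R : realType} {n : nat} {V : lmodType R[i]}.
Implicit Types (a b : 'I_n) (T : {set 'I_n}).

Lemma ext_sign_setD1 a b T : b \in T ->
  ext_sign a T = (-1) ^+ (b < a)%N * ext_sign a (T :\ b)%SET :> R[i].
Proof.
move=> bT; rewrite /ext_sign -exprD; congr (_ ^+ _).
rewrite (cardsD1 b) inE bT /=; congr (_ + _)%N; apply: eq_card => c.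
by rewrite !inE andbA.
Qed.

Lemma ext_wedgeC a b (x : ext n V) :
  ext_wedge a (ext_wedge b x) = - ext_wedge b (ext_wedge a x).
Proof.
apply/ffunP => T; rewrite !ffunE !inE.
have [->|ab] := eqVneq a b; first by rewrite /= scaler0 if_same oppr0.
rewrite /=; case: ifP => aT; case: ifP => bT; rewrite ?scaler0 ?oppr0 //.
rewrite (ext_sign_setD1 a bT) (ext_sign_setD1 b aT) !scalerA -scaleNr.
have -> : ((T :\ b) :\ a = (T :\ a) :\ b)%SET.
  by apply/setP => c; rewrite !inE andbCA.
congr (_ *: _); have : a != b :> nat by [].
by case: ltngtP => // _ _; rewrite ?expr0 ?expr1; ring.
Qed.

Lemma ext_wedge_linear a : linear (@ext_wedge R n V a).
Proof.
move=> k x y; apply/ffunP => T; rewrite !ffunE; case: ifP => _.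
  by rewrite scalerDr !scalerA mulrC.
by rewrite scaler0 addr0.
Qed.

HB.instance Definition _ a := GRing.isLinear.Build R[i] (ext n V) (ext n V) *:%R
  (ext_wedge a) (ext_wedge_linear a).

Lemma ext0_linear : linear (@ext0 R n V).
Proof.
by move=> k u v; apply/ffunP => T; rewrite !ffunE; case: ifP => _; rewrite ?scaler0 ?addr0.
Qed.

HB.instance Definition _ := GRing.isLinear.Build R[i] V (ext n V) *:%R
  (@ext0 R n V) ext0_linear.

Lemma ext_sign_set1 a : ext_sign a [set a]%SET = 1 :> R[i].
Proof.
rewrite /ext_sign eq_card0 // => b; rewrite !inE.
by case: eqP => // ->; rewrite ltnn.
Qed.

Lemma ext_sign_set0 a : ext_sign a finset.set0 = 1 :> R[i].
Proof. by rewrite /ext_sign eq_card0 // => b; rewrite !inE. Qed.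

Lemma ext_wedge_set1 a b (x : ext n V) :
  ext_wedge b x [set a]%SET = if a == b then x finset.set0 else 0.
Proof.
rewrite ffunE inE eq_sym; case: eqP => // ->.
by rewrite ext_sign_set1 scale1r finset.setDv.
Qed.

(** It serves both for 1-cochains and for elements of g (x) C^infty(M) in the Koszul complex. *)
Definition ext_one (x : 'I_n -> V) : ext n V :=
  \sum_b ext_wedge b (ext0 (x b)).

Lemma ext_one_set1 x a : ext_one x [set a]%SET = x a.
Proof.
rewrite /ext_one sum_ffunE (bigD1 a) //= big1 => [|b ba].
  by rewrite ext_wedge_set1 eqxx ffunE eqxx addr0.
by rewrite ext_wedge_set1 eq_sym (negPf ba).
Qed.

Lemma ext_one_degree x : ext_degree 1 (ext_one x).
Proof.
move=> T T1; rewrite /ext_one sum_ffunE big1 // => b _; rewrite !ffunE.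
case: ifP => // bT; case: eqP; rewrite ?scaler0 // => Tb.
by move: T1; rewrite (cardsD1 b) bT Tb cards0.
Qed.

Lemma ext_contr_one c x : ext_contr c (ext_one x) = ext0 (x c).
Proof.
apply/ffunP => T; rewrite !ffunE.
have [->|[a aT]] := set_0Vmem T.
  by rewrite inE eqxx finset.setU0 ext_one_set1 ext_sign_set0 scale1r.
have /negPf -> : T != finset.set0 by apply/finset.set0Pn; exists a.
case: ifPn => // cT; rewrite ext_one_degree ?scaler0 //.
by rewrite cardsU1 cT (cardsD1 a) aT.
Qed.

Context (g : lie_algebra R) (e : n.-tuple g) (rho : g -> V -> V).
Hypothesis rho_linear : forall xi, linear (rho xi).

Lemma linear_rep0 xi : rho xi 0 = 0.
Proof.
have /eqP := rho_linear xi 1 0 0.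
by rewrite scale1r addr0 scale1r -subr_eq0 opprD addrA subrr sub0r oppr_eq0 => /eqP.
Qed.

(** Summed against e^a /\ e^b, the cocycle condition yields Z twice, because exchanging a and b in
    the second term changes the sign of the wedge; this compensates the 1/2 in [CE_diff]. *)
Lemma CE_diff_one x :
  (forall a b, rho e`_a (x b) - rho e`_b (x a) =
               \sum_c (struct_const e c a b)%:C *: x c) ->
  CE_diff e rho (ext_one x) = 0.
Proof.
move=> x_cocycle.
pose Z := \sum_a \sum_b ext_wedge a (ext_wedge b (ext0 (rho e`_a (x b)))) : ext n V.
have ZN : \sum_a \sum_b ext_wedge a (ext_wedge b (ext0 (rho e`_b (x a)))) = - Z.
  rewrite exchange_big -sumrN; apply: eq_bigr => a _.
  by rewrite -sumrN; apply: eq_bigr => b _; rewrite ext_wedgeC.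
rewrite /CE_diff.
have -> : \sum_(a < n) ext_wedge a [ffun S => rho e`_a (ext_one x S)] = Z.
  apply: eq_bigr => a _; rewrite -linear_sum; congr ext_wedge.
  apply/ffunP => T; rewrite ffunE.
  have [/cards1P[b ->]|T1] := boolP (#|T| == 1%N).
    by rewrite ext_one_set1 (ext_one_set1 (fun b => rho e`_a (x b))).
  by rewrite !ext_one_degree // linear_rep0.
suff -> : \sum_a \sum_b \sum_c (struct_const e c a b)%:C *:
    ext_wedge a (ext_wedge b (ext_contr c (ext_one x))) = Z + Z.
  have -> : Z + Z = (2 : R[i]) *: Z by rewrite scaler_nat mulr2n.
  by rewrite scalerA mulVf ?pnatr_eq0 // scale1r addNr.
rewrite -[X in _ + X]opprK -ZN -sumrB; apply: eq_bigr => a _.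
rewrite -sumrB; apply: eq_bigr => b _.
rewrite -!linearB x_cocycle !linear_sum; apply: eq_bigr => c _.
by rewrite ext_contr_one !linearZ.
Qed.

Lemma CE_diff_degree0 y a : ext_degree 0 y ->
  CE_diff e rho y [set a]%SET = rho e`_a (y finset.set0).
Proof.
move=> y0.
have contr0 c : ext_contr c y = 0.
  apply/ffunP => T; rewrite !ffunE; case: ifP => // cT.
  by rewrite y0 ?scaler0 // cardsU1 cT.
rewrite /CE_diff big1 => [|b _]; last first.
  by rewrite big1 // => c _; rewrite big1 // => k _; rewrite contr0 !linear0.
rewrite scaler0 oppr0 add0r sum_ffunE (bigD1 a) //= big1 => [|b ba].
  by rewrite ext_wedge_set1 eqxx ffunE addr0.
by rewrite ext_wedge_set1 eq_sym (negPf ba).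
Qed.

Lemma CE_vanishes1 x : CE_vanishesS e rho 0 ->
  (forall a b, rho e`_a (x b) - rho e`_b (x a) =
               \sum_c (struct_const e c a b)%:C *: x c) ->
  exists v, forall a, rho e`_a v = x a.
Proof.
move=> H1 /CE_diff_one /(H1 _ (ext_one_degree x)) [y y0 yx].
by exists (y finset.set0) => a; rewrite -CE_diff_degree0 // yx ext_one_set1.
Qed.

End ChevalleyEilenbergDegreeOne.

(** * Extension of invariants order by order for an abstract deformed representation *)

Section Deformation.
Context {R : realType} {n : nat} {V : lmodType R[i]} {g : lie_algebra R}.
Context {e : n.-tuple g} (e_basis : basis_of fullv e).

Lemma real_linear_coord (W : lmodType R[i]) (f : g -> W) :
  (forall k xi eta, f (k *: xi + eta) = k%:C *: f xi + f eta) ->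
  forall xi, f xi = \sum_a (coord e a xi)%:C *: f e`_a.
Proof.
move=> fZD xi.
have f0 : f 0 = 0.
  have /eqP := fZD 1 0 0.
  by rewrite scale1r addr0 scale1r -subr_eq0 opprD addrA subrr sub0r oppr_eq0 => /eqP.
have fZ k x : f (k *: x) = k%:C *: f x by have := fZD k x 0; rewrite f0 !addr0.
have fD x y : f (x + y) = f x + f y by have := fZD 1 x y; rewrite !scale1r.
rewrite {1}(coord_basis e_basis (memvf xi)) (big_morph f fD f0).
by apply: eq_bigr => a _.
Qed.

Context (rho : g -> V -> V) (T : g -> fps V -> fps V).
Hypotheses
  (T_lam : forall xi, lam_linear (T xi))
  (T_real : forall k xi eta F, T (k *: xi + eta) F = k%:C *: T xi F + T eta F)
  (T_rep : forall xi eta F,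
     T xi (T eta F) - T eta (T xi F) = T (lie xi eta) F)
  (T_rho : forall xi F, T xi F 0%N = rho xi (F 0%N))
  (H1 : CE_vanishesS e rho 0).

(** Applied to F = T eta u, this turns the representation identity of [T] into a classical cocycle
    condition. *)
Lemma rep_leading_coef xi r F : (forall s, (s < r)%N -> F s = 0) ->
  T xi F r = rho xi (F r).
Proof.
elim: r F => [|r IH] F F0; first exact: T_rho.
have -> : F = lam_mul (fps_tail F).
  by apply/funext => -[|s] //=; rewrite F0.
by rewrite (lamM (T_lam xi)) /= IH // => s sr; apply: F0.
Qed.

Lemma rep_order0_linear xi : linear (rho xi).
Proof.
move=> k u v.
have E x : rho xi x = T xi (fps_const x) 0%N by rewrite T_rho.
by rewrite !E lam_const_linear.
Qed.

HB.instance Definition _ xi := GRing.isLinear.Build R[i] V V *:%R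
  (rho xi) (rep_order0_linear xi).

Lemma invariants_basis u : (forall a : 'I_n, rho e`_a u = 0) -> CE_H0 rho u.
Proof.
move=> u0 xi.
have rhoE eta : rho eta u = T eta (fps_const u) 0%N by rewrite T_rho.
rewrite (@real_linear_coord V (rho^~ u)).
  by rewrite big1 // => a _; rewrite u0 scaler0.
by move=> k x y /=; rewrite !rhoE T_real.
Qed.

Lemma qinvariants_basis F : (forall a : 'I_n, T e`_a F = 0) -> CE_H0 T F.
Proof.
move=> F0 xi; rewrite (@real_linear_coord _ (T^~ F)).
  by rewrite big1 // => a _; rewrite F0 scaler0.
by move=> k x y /=; rewrite T_real.
Qed.

Lemma invariants_deformation : is_deformation (CE_H0 rho) (CE_H0 T).
Proof.
have [d dE] : exists d : {linear V -> ('I_n -> V)},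
    forall v a, d v a = rho e`_a v.
  have d_lin : linear (fun v (a : 'I_n) => rho e`_a v).
    by move=> k u v; apply/funext => a; rewrite linearP.
  pose d : {linear V -> ('I_n -> V)} :=
    HB.pack (fun v (a : 'I_n) => rho e`_a v)
      (GRing.isLinear.Build R[i] V ('I_n -> V) *:%R _ d_lin).
  by exists d.
have [s dsd] := linear_section d.
pose T' (a : 'I_n) F := lam_div (T e`_a F - (fun r => rho e`_a (F r))).
have T'_lam a : lam_linear (T' a).
  apply: lam_linear_div => [F|]; first by rewrite !fctE T_rho subrr.
  apply: lam_linear_sub => //; exact: lam_linear_map.
have TS (a : 'I_n) F r : T e`_a F r.+1 = rho e`_a (F r.+1) + T' a F r.
  by rewrite [T' a F r]/(T e`_a F r.+1 - rho e`_a (F r.+1)) addrC subrK.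
(* Solving A u = F means u_(r+1) = F_(r+1) - s(T' u)_r, the correction that is to cancel the
   obstruction at order r+1. *)
pose A F : fps V := F + lam_mul (fun r => s (fun a => T' a F r)).
have A_lam : lam_linear A.
  apply: lam_linear_add; first exact: lam_linear_id.
  apply: (lam_linear_comp (lam_mul_linear _)); split=> [k F G|F].
    apply/funext => r; rewrite !fctE -linearP; congr (s _).
    by apply/funext => a; rewrite (lamZD (T'_lam a)).
  apply/funext => -[|r] /=.
    rewrite -[RHS](linear0 s); congr (s _); apply/funext => a.
    by rewrite (lamM (T'_lam a)).
  by congr (s _); apply/funext => a; rewrite (lamM (T'_lam a)).
have A0 F : A F 0%N = F 0%N by rewrite /A fctE addr0.
have AS F r : A F r.+1 = F r.+1 + s (fun a => T' a F r) by [].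
have [E [E_lam AK EK]] := lam_unipotent_inv A_lam A0.
have E0 F : E F 0%N = F 0%N by rewrite -[in RHS](EK F) A0.
have T_E F : (forall r, CE_H0 rho (F r)) -> CE_H0 T (E F).
  move=> F_inv; pose u := E F.
  have uS r : u r.+1 = F r.+1 - s (fun a => T' a u r).
    by rewrite -{1}[F]EK AS addrK.
  suff Tu0 r (a : 'I_n) : T e`_a u r = 0.
    by apply: qinvariants_basis => a; apply/funext => r; exact: Tu0.
  elim/ltn_ind: r a => -[|r] IH a; first by rewrite T_rho /u E0 F_inv.
  (* [x] is the lowest coefficient of T u not yet known to vanish. At this order T acts on T u
     through rho, so [T_rep] becomes the cocycle condition for [x]. *)
  pose x (b : 'I_n) := T e`_b u r.+1.
  have [b c|v vx] := @CE_vanishes1 _ _ _ g e rho rep_order0_linear x H1.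
    have lead xi (j : 'I_n) : T xi (T e`_j u) r.+1 = rho xi (x j).
      exact: rep_leading_coef (fun t tr => IH t tr j).
    rewrite -!lead -[LHS]/((T e`_b (T e`_c u) - T e`_c (T e`_b u)) r.+1) T_rep.
    rewrite (@real_linear_coord _ (T^~ u)) => [|k y z /=]; last by rewrite T_real.
    by rewrite fct_sumE.
  (* The obstruction thus lies in the image of [d], where [dsd] makes [s] a right inverse. *)
  have dy : (fun b => T' b u r) = d (v - u r.+1).
    by apply/funext => b; rewrite dE linearB /= vx /x TS addrC addKr.
  rewrite TS uS dy linearB /= (F_inv _ e`_a) sub0r.
  by rewrite -[rho e`_a (s _)]dE dsd -dy addNr.
have A_T u : CE_H0 T u -> forall r, CE_H0 rho (A u r).
  move=> Tu; case=> [|r]; first by move=> xi; rewrite A0 -T_rho Tu.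
  apply: invariants_basis => a; rewrite AS linearD /=.
  (* Here invariance of [u] itself at order r+1 puts the obstruction in the image of [d]. *)
  have -> : (fun a => T' a u r) = d (- u r.+1).
    apply/funext => b; have := TS b u r; rewrite Tu => /esym/eqP.
    by rewrite addrC addr_eq0 => /eqP ->; rewrite dE linearN.
  by rewrite -[rho e`_a (s _)]dE dsd dE linearN /= subrr.
split; first split.
- by move=> xi; rewrite (lam0 (T_lam xi)).
- move=> k F G TF TG xi.
  rewrite (lamD (T_lam xi)) (lam_fps_scale (T_lam xi)) TF TG addr0.
  by apply/funext => r; rewrite /fps_scale big1 // => j _; rewrite scaler0.
exists (fun r v => E (fps_const v) r); split=> [r k u v _ _|u _|].
- exact: lam_const_linear.
- exact: E0.
have EE F : fps_apply (fun r v => E (fps_const v) r) F = E F.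
  by apply/funext => r; rewrite (lam_linearE E_lam).
apply/seteqP; split=> [u Tu|_ [F F_inv <-]]; last by rewrite EE; exact: T_E.
by exists (A u); [exact: A_T|rewrite EE AK].
Qed.

End Deformation.

(** * Bilinearity of the star product and its commutator identities *)

Section Bilinearity.
Context {R : realType} {d : nat}.

Lemma pd_linear (U : set 'rV[R]_d) s a f h x : open U -> U x ->
  smooth_on U f -> smooth_on U h ->
  pd s (fun y => a * f y + h y) x = a * pd s f x + pd s h x.
Proof.
move=> oU + sf sh; elim: s x => [//|i s IH] x Ux /=.
have -> : 'D_(delta_mx 0 i) (pd s (fun y => a * f y + h y)) x =
          'D_(delta_mx 0 i) (a *: pd s f + pd s h) x.
  apply: near_eq_derive.
  have := open_nbhs_nbhs (conj oU Ux).
  by apply: filterS => y Uy; rewrite IH.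
have df : derivable (pd s f) x (delta_mx 0 i) by apply: diff_derivable; exact: sf.
have dh : derivable (pd s h) x (delta_mx 0 i) by apply: diff_derivable; exact: sh.
by rewrite deriveD ?deriveZ //; exact: derivableZ.
Qed.

Lemma cpd_linear (U : set 'rV[R]_d) s (a : R[i]) f h x : open U -> U x ->
  csmooth_on U f -> csmooth_on U h ->
  cpd s (fun y => a * f y + h y) x = a * cpd s f x + cpd s h x.
Proof.
move=> oU Ux [fr fi] [hr hi]; case: a => ar ai; rewrite /cpd.
have lin b k k' : smooth_on U k' -> smooth_on U k ->
    smooth_on U (fun y => b * k' y + k y).
  move=> sk' sk; apply: smooth_on_add => //; apply: smooth_on_mul => //.
  exact: smooth_on_cst.
have -> : (fun y => complex.Re ((ar +i* ai) * f y + h y)) =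
    (fun y => ar * complex.Re (f y) + ((- ai) * complex.Im (f y) + complex.Re (h y))).
  apply/funext => y; case: (f y) (h y) => p q [p' q'] /=; ring.
have -> : (fun y => complex.Im ((ar +i* ai) * f y + h y)) =
    (fun y => ar * complex.Im (f y) + (ai * complex.Re (f y) + complex.Im (h y))).
  apply/funext => y; case: (f y) (h y) => p q [p' q'] /=; ring.
rewrite !(pd_linear _ _ oU Ux) //; try exact: lin.
by apply/eqP; rewrite eq_complex /=; apply/andP; split; apply/eqP; ring.
Qed.

Context (M : manifold R d).

Lemma coordD_linear phi s (a : R[i]) (f h : Cinf M) p : atlas phi -> cdom phi p ->
  coordD phi s (a *: f + h) p = a * coordD phi s f p + coordD phi s h p.
Proof.
move=> aphi dp; apply: (cpd_linear s a (cimg_open phi)).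
- by exists p.
- exact: cfunP.
- exact: cfunP.
Qed.

Lemma cinf_eqP (f h : Cinf M) : (forall p, f p = h p) -> f = h.
Proof. by move=> fh; apply/val_inj/funext. Qed.

(** Linearity is not a field of [star_product]; it is read off pointwise from the coordinate
    expression in a chart around the point. *)
Lemma bidifferential_linearl (B : Cinf M -> Cinf M -> Cinf M) h :
  bidifferential B -> linear (B^~ h).
Proof.
move=> [k hB] a f f'; apply: cinf_eqP => p.
have [c [_ cB]] := hB _ (chart_at_atlas p); have dp := chart_at_dom p.
rewrite -[RHS]/(a * B f h p + B f' h p) !(cB _ _ _ dp) mulr_sumr -big_split.
apply: eq_bigr => s _; rewrite mulr_sumr -big_split; apply: eq_bigr => t _ /=.
rewrite coordD_linear //; [by ring | exact: chart_at_atlas].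
Qed.

Lemma bidifferential_linearr (B : Cinf M -> Cinf M -> Cinf M) h :
  bidifferential B -> linear (B h).
Proof.
move=> [k hB] a f f'; apply: cinf_eqP => p.
have [c [_ cB]] := hB _ (chart_at_atlas p); have dp := chart_at_dom p.
rewrite -[RHS]/(a * B h f p + B h f' p) !(cB _ _ _ dp) mulr_sumr -big_split.
apply: eq_bigr => s _; rewrite mulr_sumr -big_split; apply: eq_bigr => t _ /=.
rewrite coordD_linear //; [by ring | exact: chart_at_atlas].
Qed.

Context (w : symplectic_form M) (S : star_product w).

HB.instance Definition _ r h :=
  GRing.isLinear.Build R[i] (Cinf M) (Cinf M) *:%R (star_coef S r h)
    (bidifferential_linearr h (star_bidifferential S r)).

Lemma star_coefZDl r a f f' h :
  star_coef S r (a *: f + f') h = a *: star_coef S r f h + star_coef S r f' h.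
Proof. exact: (bidifferential_linearl h (star_bidifferential S r)). Qed.

Lemma star_coef0l r h : star_coef S r 0 h = 0.
Proof. by have := star_coefZDl r (-1) 0 0 h; rewrite !scaleN1r oppr0 addr0 addNr. Qed.

Lemma star_linearr F : lam_linear (star S F).
Proof.
split=> [a G G'|G]; apply/funext.
  move=> r; rewrite /star /star_of !fctE scaler_sumr -big_split.
  apply: eq_bigr => k _; rewrite scaler_sumr -big_split; apply: eq_bigr => l _.
  by rewrite linearP.
case=> [|r]; rewrite /star /star_of /=.
  by rewrite big_ord1 big_ord1 /= linear0.
rewrite big_ord_recr /= [X in _ + X]big1 ?addr0 => [|l _]; last first.
  by case: l => l /= _; rewrite subnn linear0.
apply: eq_bigr => k _; rewrite subSn -1?ltnS //.
rewrite big_ord_recr /= subnn linear0 addr0.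
by apply: eq_bigr => l _; rewrite subSn -1?ltnS.
Qed.

Lemma star_linearl G : lam_linear (fun F => star S F G).
Proof.
split=> [a F F'|F]; apply/funext.
  move=> r; rewrite /star /star_of !fctE scaler_sumr -big_split.
  apply: eq_bigr => k _; rewrite scaler_sumr -big_split; apply: eq_bigr => l _.
  by rewrite star_coefZDl.
case=> [|r]; rewrite /star /star_of /=.
  by rewrite big_ord1 big_ord1 /= star_coef0l.
rewrite big_ord_recr /= [X in _ + X]big1 ?addr0 => [|l _]; last first.
  by case: l => l /=; rewrite subnn ltnS leqn0 => /eqP ->; rewrite star_coef0l.
apply: eq_bigr => k _; rewrite subSn -1?ltnS //.
by rewrite big_ord_recl /= star_coef0l add0r.
Qed.

Lemma star_order0 F G : star S F G 0%N = F 0%N * G 0%N.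
Proof. by rewrite /star /star_of big_ord1 big_ord1 star_coef0. Qed.

Lemma star_comm_order0 F G : star_comm S F G 0%N = 0.
Proof. by rewrite /star_comm !fctE !star_order0 mulrC subrr. Qed.

Lemma star_comm_linearr F : lam_linear (star_comm S F).
Proof. exact: lam_linear_sub (star_linearr F) (star_linearl F). Qed.

Lemma star_comm_linearl G : lam_linear (fun F => star_comm S F G).
Proof. exact: lam_linear_sub (star_linearl G) (star_linearr G). Qed.

Lemma star_commM F G H :
  star_comm S F (star S G H) = star S (star_comm S F G) H + star S G (star_comm S F H).
Proof.
rewrite /star_comm (lamB (star_linearl H)) (lamB (star_linearr G)).
by rewrite /star !star_assoc addrA subrK.
Qed.

Lemma star_comm_jacobi F G H :
  star_comm S F (star_comm S G H) - star_comm S G (star_comm S F H) =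
  star_comm S (star_comm S F G) H.
Proof.
rewrite [in LHS]/star_comm !(lamB (star_linearr _)) !(lamB (star_linearl _)).
rewrite /star_comm (lamB (star_linearr _)) (lamB (star_linearl _)) /star !star_assoc.
move: (star_of _ (star_of _ F G) H) (star_of _ (star_of _ F H) G)
  (star_of _ (star_of _ G H) F) (star_of _ (star_of _ H G) F)
  (star_of _ (star_of _ G F) H) (star_of _ (star_of _ H F) G) => x y z t u v.
by rewrite !opprB addrACA !subrKA [LHS]addrACA [RHS]addrACA [- v - u]addrC.
Qed.

End Bilinearity.

Lemma complexi_neq0 (R : realType) : 'i != 0 :> R[i].
Proof. by rewrite eq_complex /= oner_eq0 andbF. Qed.

HB.instance Definition _ (R : realType) (g : lie_algebra R) (x : g) :=
  GRing.isLinear.Build R g g *:%R (lie x) (lie_linear x).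

(** * Injectivity of the momentum map on the Lie algebra *)

Section MomentumInjectivity.
Context {R : realType} {d n : nat} {M : manifold R d} {g : lie_algebra R}.
Context {e : n.-tuple g} (e_basis : basis_of fullv e).

Lemma qpairing_linear (JJ : fps (dual_map M g)) k xi eta :
  qpairing JJ (k *: xi + eta) = k%:C *: qpairing JJ xi + qpairing JJ eta.
Proof.
apply/funext => r; apply: cinf_eqP => p.
rewrite -[RHS]/(k%:C * (JJ r p xi)%:C + (JJ r p eta)%:C).
by rewrite /= linearP rmorphD rmorphM.
Qed.

(* At a point of the regular constraint surface the differentials of the
   components of [J] are linearly independent. *)
Lemma pairing_inj (J : dual_map M g) p xi : regular_value J 0 -> J p = 0 ->
  pairing J xi = 0 -> xi = 0.
Proof.
move=> regJ Jp Jxi; rewrite (coord_basis e_basis (memvf xi)) big1 // => a _.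
have [v vE] := regJ p Jp (linfun (coord e a : g -> R^o)).
have := vE xi; rewrite lfunE /= => <-; rewrite big1 ?scale0r // => j _.
have J0 q : J q xi = 0.
  have : pairing J xi q = 0 by rewrite Jxi.
  by move/eqP; rewrite eq_complex /= => /andP[/eqP].
rewrite /rcoordD; have -> : (fun q => J q xi) \o cinv (chart_at p) = cst 0.
  by apply/funext => x /=; rewrite J0.
by rewrite pd1E derive_cst mulr0.
Qed.

End MomentumInjectivity.

(** * Quantum Koszul operators and their equivariance *)

Section QuantumKoszul.
Context {R : realType} {d n : nat} {M : manifold R d} {w : symplectic_form M}
  {S : star_product w} {g : lie_algebra R} {e : n.-tuple g}
  {JJ : fps (dual_map M g)}.
Hypotheses (e_basis : basis_of fullv e) (hJ : quantum_momentum_map S JJ)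
  (J_inj : forall xi, pairing (JJ 0%N) xi = 0 -> xi = 0).
Implicit Types (xi eta : g) (F G : fps (Cinf M)).

Lemma qpairing_inj : injective (qpairing JJ).
Proof.
move=> xi eta E; have := qpairing_linear JJ (-1) xi eta.
rewrite rmorphN1 !scaleN1r E addNr => /(congr1 (fun F => F 0%N)) /J_inj /eqP.
by rewrite addrC subr_eq0 => /eqP ->.
Qed.

Lemma momentum_comm xi eta : star_comm S (qpairing JJ xi) (qpairing JJ eta) =
  lam_mul ('i *: qpairing JJ (lie xi eta)).
Proof. by case: hJ. Qed.

Lemma scalei_lam_inj F G : lam_mul ('i *: F) = lam_mul ('i *: G) -> F = G.
Proof. by move/lam_mulI/scalerI => -> //; exact: complexi_neq0. Qed.

(* [lie_algebra] only requires linearity in the second argument of the bracket;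
   the first one follows from the injectivity of the momentum map. *)
Lemma lieC xi eta : lie xi eta = - lie eta xi.
Proof.
apply: qpairing_inj; apply: scalei_lam_inj; rewrite -momentum_comm.
have -> : qpairing JJ (- lie eta xi) = - qpairing JJ (lie eta xi).
  have := qpairing_linear JJ (-1) (lie eta xi) 0.
  rewrite rmorphN1 !scaleN1r addr0 => ->; rewrite -[RHS]addr0; congr (_ + _).
  have := qpairing_linear JJ (-1) 0 0.
  by rewrite rmorphN1 !scaleN1r addr0 oppr0 addNr.
by rewrite scalerN (lamN (lam_mul_linear _)) -momentum_comm /star_comm opprB.
Qed.

Lemma lieZDl k (x y z : g) : lie (k *: x + y) z = k *: lie x z + lie y z.
Proof.
by rewrite lieC lie_linear opprD -scalerN -!lieC.
Qed.

Lemma lie_lie (x y z : g) : lie (lie x y) z = lie x (lie y z) - lie y (lie x z).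
Proof.
have := lie_jacobi x y z; rewrite [lie z x]lieC [lie z (lie x y)]lieC.
rewrite linearN /=.
by move/eqP; rewrite subr_eq0 => /eqP ->.
Qed.

Lemma half_trace_ad_linear k (x y : g) :
  half_trace_ad e (k *: x + y) = k * half_trace_ad e x + half_trace_ad e y.
Proof.
rewrite /half_trace_ad mulrCA -mulrDr; congr (_ * _); rewrite mulr_sumr -big_split.
by apply: eq_bigr => a _; rewrite lieZDl linearP.
Qed.

(** ad [x, y] is the commutator of ad x and ad y, and commutators have trace zero; [tr u v] is the
    trace of ad u o ad v. *)
Lemma half_trace_ad_lie (x y : g) : half_trace_ad e (lie x y) = 0.
Proof.
pose tr (u v : g) := \sum_(a < n) coord e a (lie u (lie v e`_a)).
have trE u v : tr u v =
    \sum_(a < n) \sum_(b < n) coord e b (lie v e`_a) * coord e a (lie u e`_b).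
  apply: eq_bigr => a _; rewrite {1}(coord_basis e_basis (memvf (lie v e`_a))).
  by rewrite !linear_sum; apply: eq_bigr => b _; rewrite !linearZ.
rewrite /half_trace_ad.
have -> : \sum_(a < n) coord e a (lie (lie x y) e`_a) = tr x y - tr y x.
  by rewrite -sumrB; apply: eq_bigr => a _; rewrite lie_lie linearB.
suff -> : tr y x = tr x y by rewrite subrr mulr0.
rewrite !trE exchange_big; apply: eq_bigr => a _; apply: eq_bigr => b _.
exact: mulrC.
Qed.

Lemma qrepM_linear xi : lam_linear (qrepM S JJ xi).
Proof.
apply: lam_linear_scale; apply: lam_linear_div (star_comm_linearr S _).
exact: star_comm_order0.
Qed.

Lemma lam_qrepM xi F :
  lam_mul ('i *: qrepM S JJ xi F) = star_comm S (qpairing JJ xi) F.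
Proof.
rewrite /qrepM scalerA mulfV ?complexi_neq0 // scale1r lam_mul_div //.
exact: star_comm_order0.
Qed.

Lemma qrepM_real k xi eta F :
  qrepM S JJ (k *: xi + eta) F = k%:C *: qrepM S JJ xi F + qrepM S JJ eta F.
Proof.
rewrite /qrepM qpairing_linear (lamZD (star_comm_linearl S F)) lam_divZD.
by rewrite scalerDr !scalerA mulrC.
Qed.

Lemma qrepM_rep xi eta F :
  qrepM S JJ xi (qrepM S JJ eta F) - qrepM S JJ eta (qrepM S JJ xi F) =
  qrepM S JJ (lie xi eta) F.
Proof.
have star_lami x G : star_comm S (qpairing JJ x) (lam_mul ('i *: G)) =
    lam_mul ('i *: star_comm S (qpairing JJ x) G).
  by rewrite (lamM (star_comm_linearr S _)) (lamZ (star_comm_linearr S _)).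
(* Multiplied by (i lambda)^2, the claim is the Jacobi identity for star commutators combined with
   the quantum momentum condition. *)
apply: scalei_lam_inj; apply: scalei_lam_inj.
rewrite !scalerBr !(lamB (lam_mul_linear _)) scalerBr (lamB (lam_mul_linear _)).
rewrite !lam_qrepM -!star_lami !lam_qrepM star_comm_jacobi momentum_comm.
by rewrite (lamM (star_comm_linearl S F)) (lamZ (star_comm_linearl S F)).
Qed.

(** The quantum Koszul operator on the single tensor xi (x) F. *)
Definition rmomentum xi F : fps (Cinf M) :=
  star S F (qpairing JJ xi) + lam_mul (('i * (half_trace_ad e xi)%:C) *: F).

Lemma rmomentum_linear xi : lam_linear (rmomentum xi).
Proof.
apply: lam_linear_add (star_linearl S _) _.
exact: lam_linear_comp (lam_mul_linear _) (lam_linear_scale _ (lam_linear_id _)).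
Qed.

Lemma rmomentum_real k xi eta F :
  rmomentum (k *: xi + eta) F = k%:C *: rmomentum xi F + rmomentum eta F.
Proof.
rewrite /rmomentum qpairing_linear (lamZD (star_linearr S _)) half_trace_ad_linear.
rewrite rmorphD rmorphM mulrDr scalerDl (lamD (lam_mul_linear _)) scalerDr addrACA.
congr (_ + _ + _); rewrite -(lamZ (lam_mul_linear _)) scalerA.
by rewrite mulrCA.
Qed.

Lemma rmomentum_order0 xi F : rmomentum xi F 0%N = F 0%N * pairing (JJ 0%N) xi.
Proof. by rewrite /rmomentum fctE star_order0 addr0. Qed.

(** Right multiplications compose in the opposite order, hence the reversed bracket. The cross terms
    with chi are symmetric in [xi] and [eta] and cancel, and chi vanishes on the bracket on the
    right. *)
Lemma rmomentum_comm xi eta F :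
  rmomentum xi (rmomentum eta F) - rmomentum eta (rmomentum xi F) =
  lam_mul ('i *: rmomentum (lie eta xi) F).
Proof.
have E x y : rmomentum x (rmomentum y F) =
    star S (star S F (qpairing JJ y)) (qpairing JJ x) +
    (lam_mul (('i * (half_trace_ad e y)%:C) *: star S F (qpairing JJ x)) +
     lam_mul (('i * (half_trace_ad e x)%:C) *: star S F (qpairing JJ y)) +
     lam_mul (lam_mul (('i * (half_trace_ad e x)%:C * ('i * (half_trace_ad e y)%:C)) *: F))).
  rewrite /rmomentum (lamD (star_linearl S _)) (lamM (star_linearl S _)).
  rewrite (lamZ (star_linearl S _)) scalerDr (lamD (lam_mul_linear _)) !addrA.
  by rewrite -(lamZ (lam_mul_linear _)) scalerA.
rewrite !E opprD addrACA [X in _ + X](_ : _ = 0) ?addr0; last first.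
  by rewrite [X in _ - (X + _)]addrC [X in _ - (_ + lam_mul (lam_mul (X *: _)))]mulrC subrr.
rewrite /rmomentum half_trace_ad_lie rmorph0 mulr0 scale0r (lam0 (lam_mul_linear _)) addr0.
rewrite /star -!star_assoc -/(star S) -(lamB (star_linearr S F)).
rewrite -[_ - _]/(star_comm S (qpairing JJ eta) (qpairing JJ xi)) momentum_comm.
by rewrite (lamM (star_linearr S F)) (lamZ (star_linearr S F)).
Qed.

(** [qrepM] acts by derivations of the star product and sends the momentum of [eta] to that of the
    bracket, where chi contributes nothing. *)
Lemma qrepM_rmomentum xi eta F : qrepM S JJ xi (rmomentum eta F) =
  rmomentum eta (qrepM S JJ xi F) + rmomentum (lie xi eta) F.
Proof.
apply: scalei_lam_inj; rewrite scalerDr (lamD (lam_mul_linear _)) lam_qrepM.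
rewrite -(lamZ (rmomentum_linear _)) -(lamM (rmomentum_linear _)) lam_qrepM.
rewrite {1 2}/rmomentum (lamD (star_comm_linearr S _)) star_commM momentum_comm.
rewrite (lamM (star_linearr S F)) (lamZ (star_linearr S F)).
rewrite (lamM (star_comm_linearr S _)) (lamZ (star_comm_linearr S _)) addrAC.
congr (_ + _); rewrite /rmomentum half_trace_ad_lie rmorph0 mulr0 scale0r.
by rewrite (lam0 (lam_mul_linear _)) addr0.
Qed.

(* [X a] is the coefficient of [e_a] in an element of [g (x) C^infty(M)[[lambda]]]. *)
Definition qkos (X : 'I_n -> fps (Cinf M)) : fps (Cinf M) :=
  \sum_(a < n) rmomentum e`_a (X a).

Lemma qkosE x : qkoszul1 S e JJ x = qkos (fun a r => x r [set a]%SET).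
Proof. by []. Qed.

Lemma qkosB X Y : qkos (X - Y) = qkos X - qkos Y.
Proof.
by rewrite /qkos -sumrB; apply: eq_bigr => a _; rewrite -(lamB (rmomentum_linear _)).
Qed.

Lemma qkosM X : qkos (fun a => lam_mul (X a)) = lam_mul (qkos X).
Proof.
rewrite /qkos (lam_sum (lam_mul_linear _)); apply: eq_bigr => a _.
exact: (lamM (rmomentum_linear _)).
Qed.

Lemma qkos_order0 X : qkos X 0%N = \sum_(a < n) X a 0%N * pairing (JJ 0%N) e`_a.
Proof. by rewrite /qkos fct_sumE; apply: eq_bigr => a _; rewrite rmomentum_order0. Qed.

Lemma qrepM_qkos xi X : exists Y, qrepM S JJ xi (qkos X) = qkos Y.
Proof.
(* The action on g (x) C^infty(M)[[lambda]] is the tensor product of the adjoint representation with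
   [qrepM]. *)
exists (fun b => qrepM S JJ xi (X b) +
  \sum_(a < n) (coord e b (lie xi e`_a))%:C *: X a).
rewrite /qkos (lam_sum (qrepM_linear xi)).
under eq_bigr do rewrite qrepM_rmomentum.
under [in RHS]eq_bigr do rewrite (lamD (rmomentum_linear _)) (lam_sum (rmomentum_linear _)).
rewrite [LHS]big_split [RHS]big_split [in RHS]exchange_big /=; congr (_ + _).
apply: eq_bigr => a _.
rewrite (real_linear_coord e_basis (f := rmomentum^~ (X a))) => [|k x y]; last first.
  exact: rmomentum_real.
by apply: eq_bigr => b _; rewrite (lamZ (rmomentum_linear _)).
Qed.

(* An antisymmetric family [Y] encodes the bivector [1/2 sum_(a, b) Y a b e_a /\ e_b]. *)
Definition qkos2 (Y : 'I_n -> 'I_n -> fps (Cinf M)) (a : 'I_n) : fps (Cinf M) :=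
  \sum_(b < n) rmomentum e`_b (Y b a) -
  lam_mul ((2^-1 * 'i) *: \sum_(b < n) \sum_(c < n) (struct_const e a b c)%:C *: Y b c).

(** By antisymmetry the double application Z of [rmomentum] is half a sum of commutators, that is (i
    lambda / 2) L; this is the origin of the factor [2^-1 * 'i] in [qkos2]. *)
Lemma qkos_qkos2 Y : (forall a b, Y a b = - Y b a) -> qkos (qkos2 Y) = 0.
Proof.
move=> YC.
pose Z := \sum_(a < n) \sum_(b < n) rmomentum e`_a (rmomentum e`_b (Y b a)).
pose L := \sum_(a < n) \sum_(b < n) \sum_(c < n)
  (struct_const e c b a)%:C *: rmomentum e`_c (Y b a).
have ZL : Z + Z = lam_mul ('i *: L).
  have {2}-> : Z = - \sum_(a < n) \sum_(b < n) rmomentum e`_b (rmomentum e`_a (Y b a)).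
    rewrite /Z exchange_big -sumrN; apply: eq_bigr => a _.
    rewrite -sumrN; apply: eq_bigr => b _.
    by rewrite YC (lamN (rmomentum_linear _)) (lamN (rmomentum_linear _)).
  rewrite -sumrB /L scaler_sumr (lam_sum (lam_mul_linear _)); apply: eq_bigr => a _.
  rewrite -sumrB scaler_sumr (lam_sum (lam_mul_linear _)); apply: eq_bigr => b _.
  rewrite rmomentum_comm; congr (lam_mul (_ *: _)).
  rewrite (real_linear_coord e_basis (f := rmomentum^~ (Y b a))) // => k x y.
  exact: rmomentum_real.
have -> : qkos (qkos2 Y) = Z - lam_mul ((2^-1 * 'i) *: L).
  rewrite /qkos /qkos2; under eq_bigr do rewrite (lamB (rmomentum_linear _))
    (lam_sum (rmomentum_linear _)) (lamM (rmomentum_linear _)) (lamZ (rmomentum_linear _)).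
  rewrite sumrB -(lam_sum (lam_mul_linear _)) -scaler_sumr; congr (_ - lam_mul (_ *: _)).
  under eq_bigr do rewrite (lam_sum (rmomentum_linear _)).
  under eq_bigr do under eq_bigr do rewrite (lam_sum (rmomentum_linear _)).
  rewrite /L exchange_big /=; under eq_bigr do rewrite exchange_big.
  rewrite exchange_big /=; apply: eq_bigr => a _; apply: eq_bigr => b _.
  by apply: eq_bigr => c _; rewrite (lamZ (rmomentum_linear _)).
apply/eqP; rewrite -scalerA (lamZ (lam_mul_linear _)) -ZL subr_eq0.
have -> : Z + Z = (2 : R[i]) *: Z by rewrite scaler_nat mulr2n.
by rewrite scalerA mulVf ?pnatr_eq0 // scale1r.
Qed.

End QuantumKoszul.

(** * Antisymmetry of contractions *)

Section Contractions.
Context {R : realType} {n : nat} {V : lmodType R[i]}.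

Lemma ext_contr_set0 a (x : ext n V) : ext_contr a x finset.set0 = x [set a]%SET.
Proof. by rewrite ffunE inE ext_sign_set0 scale1r finset.setU0. Qed.

Lemma ext_contrC a b (x : ext n V) :
  ext_contr b x [set a]%SET = - ext_contr a x [set b]%SET.
Proof.
rewrite !ffunE !inE eq_sym; have [_|ab] := eqVneq a b; first by rewrite oppr0.
have sE c k : c != k -> ext_sign c [set k]%SET = (-1) ^+ (k < c)%N :> R[i].
  move=> ck; rewrite /ext_sign; congr (_ ^+ _).
  case: (boolP (k < c)%N) => kc.
    by apply/eqP/cards1P; exists k; apply/setP => l; rewrite !inE;
       case: eqP => // ->; rewrite kc.
  by apply: eq_card0 => l; rewrite !inE; case: eqP => // ->; rewrite (negPf kc).
rewrite !sE // 1?eq_sym // finset.setUC -scaleNr; congr (_ *: _).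
have : a != b :> nat by [].
by case: ltngtP => // _ _; rewrite ?expr0 ?expr1 ?opprK.
Qed.

End Contractions.

(** * The quantum restriction map and the reduced representation *)

Section QuantumReduction.
Context {R : realType} {d m n : nat} {M : manifold R d} {w : symplectic_form M}
  {S : star_product w} {g : lie_algebra R} {e : n.-tuple g}
  {JJ : fps (dual_map M g)} {C : manifold R m} {iota : embedding C M}
  {prol : {linear Cinf C -> Cinf M}}
  {h : {linear ext n (Cinf M) -> ext n (Cinf M)}}.
Hypotheses (e_basis : basis_of fullv e) (hJ : quantum_momentum_map S JJ)
  (J_inj : forall xi, pairing (JJ 0%N) xi = 0 -> xi = 0)
  (J_vanish : forall xi, pullback iota (pairing (JJ 0%N) xi) = 0)
  (h_homotopy : koszul_homotopy e JJ iota prol h).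
Implicit Types (xi eta : g) (F G : fps (Cinf M)) (u v : fps (Cinf C)).

Local Notation qkos := (qkos (S := S) (e := e) (JJ := JJ)).

Lemma pullback_linear : linear (pullback iota).
Proof. by move=> a f f'; apply: cinf_eqP. Qed.

HB.instance Definition _ := GRing.isLinear.Build R[i] (Cinf M) (Cinf C) *:%R
  (pullback iota) pullback_linear.

Lemma pullbackM f f' : pullback iota (f * f') = pullback iota f * pullback iota f'.
Proof. exact: cinf_eqP. Qed.

Lemma pullback_prol f : pullback iota (prol f) = f.
Proof. by case: h_homotopy. Qed.

Lemma pullback_qkos0 X : pullback iota (qkos X 0%N) = 0.
Proof.
rewrite qkos_order0 linear_sum /= big1 // => a _.
by rewrite pullbackM J_vanish mulr0.
Qed.

Lemma koszulE x T : koszul e JJ x T =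
  \sum_(a < n) pairing (JJ 0%N) e`_a * ext_contr a x T.
Proof. by rewrite /koszul sum_ffunE; apply: eq_bigr => a _; rewrite ffunE. Qed.

(* A relation [qkos X = prol u] forces [X] to be a classical boundary at lowest
   order; subtracting its quantum lift [qkos2 Y] makes [X] divisible by lambda. *)
Lemma qkos_prol X u : qkos X = (fun r => prol (u r)) -> u = 0.
Proof.
move=> E; apply/funext => r; elim: r X u E => [|r IH] X u E.
  by have := pullback_qkos0 X; rewrite E pullback_prol.
have u0 : u 0%N = 0 by have := pullback_qkos0 X; rewrite E pullback_prol.
have [h_deg _ _ h_hom _] := h_homotopy.
pose x : ext n (Cinf M) := ext_one (fun a => X a 0%N).
have x1 : ext_degree 1 x by exact: ext_one_degree.
have kx : koszul e JJ x = 0.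
  apply/ffunP => T; rewrite koszulE [RHS]ffunE.
  have [->|[a aT]] := set_0Vmem T.
    have := congr1 (fun F => F 0%N) E; rewrite qkos_order0 u0 linear0 => E0.
    rewrite -[RHS]E0.
    by apply: eq_bigr => a _; rewrite ext_contr_set0 ext_one_set1 mulrC.
  apply: big1 => b _; rewrite ffunE; case: ifPn => [_|bT]; first by rewrite mulr0.
  rewrite x1 ?scaler0 ?mulr0 //.
  by rewrite cardsU1 bT (cardsD1 a) aT.
have := h_hom 1%N x isT x1; rewrite kx linear0 add0r; set y := h x => ky.
(* The components of the classical bivector [y], taken constant in lambda; at order 0, [qkos2 Y] is
   the Koszul boundary of [y], which is [x]. *)
pose Y a b := fps_const (ext_contr a y [set b]%SET).
have YC a b : Y a b = - Y b a.
  by apply/funext => -[|s]; rewrite /Y fctE /= ?oppr0 // ext_contrC.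
have kY := qkos_qkos2 e_basis hJ J_inj YC.
pose X' := X - qkos2 (S := S) (e := e) (JJ := JJ) Y.
have X'0 a : X' a 0%N = 0.
  rewrite /X' /qkos2 !fctE fct_sumE subr0.
  under eq_bigr do rewrite rmomentum_order0 mulrC.
  by rewrite -koszulE ky ext_one_set1 subrr.
have X'E : X' = fun a => lam_mul (lam_div (X' a)).
  by apply/funext => a; rewrite lam_mul_div.
apply: (IH (fun a => lam_div (X' a)) (fps_tail u)).
apply: lam_mulI; rewrite -qkosM -X'E qkosB kY subr0 E.
by apply/funext => -[|s] //=; rewrite u0 linear0.
Qed.

Definition qhom F (a : 'I_n) : fps (Cinf M) := fun r => h0 (n := n) h F r [set a]%SET.

(* By the homotopy identity this is [id - lambda B1 h0]. *)
Definition qdef F : fps (Cinf M) :=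
  (fun r => prol (pullback iota (F r))) + qkos (qhom F).

Lemma qdefE F : F - lam_mul (B1 S e JJ (h0 h F)) = qdef F.
Proof.
(* The classical and quantum Koszul operators agree at order 0, so the division by lambda in [B1] is
   exact. *)
rewrite /B1 lam_mul_div; last first.
  rewrite !fctE qkosE qkos_order0 /koszul1 koszulE -sumrB big1 // => a _.
  by rewrite ext_contr_set0 mulrC subrr.
rewrite /qdef qkosE opprB addrCA [RHS]addrC; congr (_ + _).
apply/funext => r; rewrite !fctE /koszul1.
have [_ _ hh _ _] := h_homotopy.
by rewrite -[in LHS](hh (F r)) addrK.
Qed.

Lemma qhom_linear a : lam_linear (fun F => qhom F a).
Proof.
split=> [k F G|F]; apply/funext.
  by move=> r; rewrite /qhom /h0 !fctE !linearP !ffunE.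
by case=> [|r] //; rewrite /qhom /h0 /= !linear0 ffunE.
Qed.

Lemma qdef_linear : lam_linear qdef.
Proof.
apply: lam_linear_add.
  exact: lam_linear_comp (lam_linear_map prol) (lam_linear_map (pullback iota)).
apply: lam_linear_sum => a.
exact: lam_linear_comp (rmomentum_linear _) (qhom_linear a).
Qed.

Lemma qdef_order0 F : qdef F 0%N = F 0%N.
Proof. by rewrite -qdefE fctE /= subr0. Qed.

Local Notation qpb := (qpullback S e JJ iota h).

Lemma qpullbackE F : exists2 G, qdef G = F & qpb F = pullback iota \o G.
Proof.
have [G GE] := lam_unipotent_surj qdef_linear qdef_order0 F.
exists G => //; rewrite /qpullback; congr (_ \o _).
apply: xget_subset1; first by rewrite /= qdefE.
move=> G1 G2; rewrite /= !qdefE => E1 E2.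
by apply: (lam_unipotent_inj qdef_linear qdef_order0); rewrite E1 E2.
Qed.

Lemma qpullbackK G : qpb (qdef G) = pullback iota \o G.
Proof.
have [G' E ->] := qpullbackE (qdef G).
by rewrite (lam_unipotent_inj qdef_linear qdef_order0 E).
Qed.

Lemma qpullback_linear : lam_linear qpb.
Proof.
have [B [hB _ BK]] := lam_unipotent_inv qdef_linear qdef_order0.
have -> : qpb = fun F => pullback iota \o B F.
  by apply/funext => F; rewrite -{1}[F]BK qpullbackK.
exact: lam_linear_comp (lam_linear_map (pullback iota)) hB.
Qed.

Lemma qpullback_order0 F : qpb F 0%N = pullback iota (F 0%N).
Proof. by have [G <- ->] := qpullbackE F; rewrite qdef_order0. Qed.

(** In particular the kernel of the quantum restriction map lies in the image of [qkos]. Both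
    summands come from the definition of [qdef] at the preimage of [F]. *)
Lemma qpullback_decomp F : exists X, F = (prol \o qpb F) + qkos X.
Proof. by have [G <- ->] := qpullbackE F; exists (qhom G). Qed.

(** If qkos X = qdef G, then [qkos] sends X - qhom G to the prolongation of the restriction of G,
    which vanishes by [qkos_prol]. *)
Lemma qpullback_qkos X : qpb (qkos X) = 0.
Proof.
have [G E ->] := qpullbackE (qkos X).
apply: (@qkos_prol (X - qhom G)).
by rewrite qkosB -E /qdef addrK.
Qed.

Local Notation qrep := (qrepC S e JJ iota prol h).

Lemma qrepC_linear xi : lam_linear (qrep xi).
Proof.
apply: (lam_linear_comp qpullback_linear).
exact: lam_linear_comp (qrepM_linear xi) (lam_linear_map prol).
Qed.

Lemma qrepC_real k xi eta u :
  qrep (k *: xi + eta) u = k%:C *: qrep xi u + qrep eta u.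
Proof. by rewrite /qrepC qrepM_real (lamZD qpullback_linear). Qed.

(** Between the two actions, restricting and prolonging changes the function only by a quantum
    Koszul boundary; [qrepM] maps it to another boundary, which [qpb] kills. *)
Lemma qrepC_comp xi eta u :
  qrep xi (qrep eta u) = qpb (qrepM S JJ xi (qrepM S JJ eta (prol \o u))).
Proof.
rewrite /qrepC; set F := qrepM S JJ eta _.
have [X FE] := qpullback_decomp F.
have [Y YE] := qrepM_qkos e_basis hJ J_inj xi X.
rewrite [in RHS]FE (lamD (qrepM_linear xi)) YE (lamD qpullback_linear).
by rewrite qpullback_qkos addr0.
Qed.

Lemma qrepC_rep xi eta u :
  qrep xi (qrep eta u) - qrep eta (qrep xi u) = qrep (lie xi eta) u.
Proof. by rewrite !qrepC_comp -(lamB qpullback_linear) qrepM_rep. Qed.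

End QuantumReduction.

(** * Classical limit of the reduced representation *)

Section ClassicalLimit.
Context {R : realType} {m d : nat} {C : manifold R m} {M : manifold R d}.

(** The chain rule in the preferred charts; [k] stands for the real or the imaginary part. *)
Lemma pd_pullback (F : C -> M) (k : R[i] -> R) (f : M -> R[i]) c i :
  smooth_map F ->
  smooth_on (cmap (chart_at (F c)) @` cdom (chart_at (F c)))
    (fun x => k (f (cinv (chart_at (F c)) x))) ->
  pd [:: i] (fun y => k (f (F (cinv (chart_at c) y)))) (cmap (chart_at c) c) =
  \sum_j tangent_mx F c i j *
    pd [:: j] (fun x => k (f (cinv (chart_at (F c)) x))) (cmap (chart_at (F c)) (F c)).
Proof.
move=> [cF sF] sf; set phi := chart_at c; set psi := chart_at (F c).
have dc : cdom phi c by exact: chart_at_dom.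
have dFc : cdom psi (F c) by exact: chart_at_dom.
pose G x := cmap psi (F (cinv phi x)).
pose kf x := k (f (cinv psi x)).
have Gc : G (cmap phi c) = cmap psi (F c) by rewrite /G cmapK.
have -> : pd [:: i] (fun y => k (f (F (cinv phi y)))) (cmap phi c) =
          pd [:: i] (kf \o G) (cmap phi c).
  (* [cinv psi] inverts [cmap psi] only on the chart domain, so the two functions agree only near
     the point. *)
  apply: near_eq_derive.
  have : nbhs (cmap phi c) (cinv phi @^-1` (F @^-1` cdom psi)).
    apply: cinv_cts => //; rewrite cmapK //; apply: open_nbhs_nbhs; split=> //.
    by apply: open_comp; [move=> x _; exact: cF|exact: cdom_open].
  by apply: filterS => x Wx; rewrite /kf /G /= cmapK.
rewrite pd1_comp.
- by apply: eq_bigr => j _; rewrite Gc mulrC [tangent_mx F c i j]mxE.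
- move=> j; apply: (sF phi psi (chart_at_atlas c) (chart_at_atlas _) j [::]).
  by exists c.
- by rewrite Gc; apply: (sf [::]); exists (F c).
Qed.

Lemma coordD_pullback (F : embedding C M) (f : Cinf M) c i :
  coordD (chart_at c) [:: i] (pullback F f) c =
  \sum_j (tangent_mx F c i j)%:C * coordD (chart_at (F c)) [:: j] f (F c).
Proof.
have [fr fi] := cfunP f (chart_at_atlas (F c)).
have := pd_pullback i (emb_smooth F) fr; have := pd_pullback i (emb_smooth F) fi.
rewrite /coordD /cpd /= => -> ->; apply/eqP; rewrite eq_complex /=.
rewrite !(raddf_sum (@complex.Re R)) !(raddf_sum (@complex.Im R)).
by apply/andP; split; apply/eqP/eq_bigr => j _ /=; rewrite mul0r ?subr0 ?addr0.
Qed.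

(** omega(X_f, X_k) = - omega(X_k, X_f) = - dk(X_f); this is the source of the sign in the classical
    representation. *)
Lemma poissonE (w : symplectic_form M) f k p :
  poisson w f k p = - (ham_vec w f p *m (grad k p)^T) 0 0.
Proof.
have wT : (om_at w p)^T = - om_at w p.
  have /matrixP sk := om_skew w (chart_at_atlas p) (chart_at_dom p).
  by apply/matrixP => i j; have := sk i j; rewrite !mxE => ->; rewrite rmorphN.
have wU : om_at w p \in unitmx.
  rewrite -[om_at w p]/(map_mx (real_complex R) _) map_unitmx.
  by apply: om_nondegenerate; [exact: chart_at_atlas|exact: chart_at_dom].
rewrite /poisson {2}/ham_vec trmx_mul trmx_inv wT !mulmxA.
rewrite -(mulmxA (ham_vec w f p)).
have -> : om_at w p *m invmx (- om_at w p) = - 1%:M.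
  rewrite -[X in X *m _]opprK mulNmx mulmxV //.
  by rewrite -scaleN1r unitmxZ // unitrN1.
by rewrite mulmxN mulmx1 mulNmx mxE.
Qed.

Context {n : nat} {w : symplectic_form M} {S : star_product w} {g : lie_algebra R}
  {e : n.-tuple g} {JJ : fps (dual_map M g)} {iota : embedding C M}.

(** At first order in lambda the terms with C_0 are commutative products and cancel, leaving the
    antisymmetric part of C_1, which is i times the Poisson bracket. *)
Lemma qrepM_order0 xi F p :
  qrepM S JJ xi F 0%N p = poisson w (pairing (JJ 0%N) xi) (F 0%N) p.
Proof.
have star1 G H : star S G H 1%N =
    G 0%N * H 1%N + G 1%N * H 0%N + star_coef S 1 (G 0%N) (H 0%N).
  by rewrite /star /star_of !big_ord_recl !big_ord0 /= !addr0 !star_coef0.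
rewrite -[LHS]/('i^-1 * star_comm S (qpairing JJ xi) F 1%N p).
have -> : star_comm S (qpairing JJ xi) F 1%N =
    star_coef S 1 (pairing (JJ 0%N) xi) (F 0%N) -
    star_coef S 1 (F 0%N) (pairing (JJ 0%N) xi).
  rewrite /star_comm !fctE !star1 opprD addrACA [F 0%N * _]mulrC [F 1%N * _]mulrC.
  by rewrite [X in X - _]addrC subrr add0r.
by rewrite -[X in _ * X]/(_ - _) star_coef1 mulKf // complexi_neq0.
Qed.

(** On C the Hamiltonian vector field is the image of xi_C under the tangent map of the inclusion,
    so the chain rule lets it act after restriction. *)
Lemma qrepM_restrict xiC (f : fps (Cinf M)) xi : restricted_action w (JJ 0%N) iota xiC ->
  pullback iota (qrepM S JJ xi f 0%N) = classical_rep xiC xi (pullback iota (f 0%N)).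
Proof.
move=> xiE; apply: cinf_eqP => c.
rewrite -[LHS]/(qrepM S JJ xi f 0%N (iota c)) qrepM_order0 poissonE -xiE.
rewrite -[RHS]/(- \sum_j (xiC xi c 0 j)%:C *
  coordD (chart_at c) [:: j] (pullback iota (f 0%N)) c); congr (- _).
under [RHS]eq_bigr do rewrite coordD_pullback mulr_sumr.
rewrite exchange_big mxE; apply: eq_bigr => k _.
rewrite !mxE rmorph_sum mulr_suml; apply: eq_bigr => j _.
by rewrite rmorphM mulrA.
Qed.

End ClassicalLimit.

Theorem theorem34 (R : realType) (d m n : nat)
  (M : manifold R d) (w : symplectic_form M) (S : star_product w)
  (g : lie_algebra R) (e : n.-tuple g) (e_basis : basis_of fullv e)
  (JJ : fps (dual_map M g)) (JJ_momentum : quantum_momentum_map S JJ)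
  (C : manifold R m) (iota : embedding C M)
  (C_regular : regular_constraint_surface (JJ 0%N) iota)
  (xiC : g -> vector_field C)
  (xiC_restricted : restricted_action w (JJ 0%N) iota xiC)
  (prol : {linear Cinf C -> Cinf M})
  (h : {linear ext n (Cinf M) -> ext n (Cinf M)})
  (h_homotopy : koszul_homotopy e JJ iota prol h)
  (H1_vanishes : CE_vanishesS e (classical_rep xiC) 0) :
  is_deformation (CE_H0 (classical_rep xiC))
    (CE_H0 (qrepC S e JJ iota prol h)).
Proof.
have [regJ imJ [c0 _]] := C_regular.
have J0 c : JJ 0%N (iota c) = 0.
  have : range iota (iota c) by exists c.
  by rewrite imJ.
(* Nonemptiness of C enters here: it supplies a zero of J at which regularity applies. *)
have J_inj xi : pairing (JJ 0%N) xi = 0 -> xi = 0.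
  exact: (pairing_inj e_basis regJ (J0 c0)).
have J_vanish xi : pullback iota (pairing (JJ 0%N) xi) = 0.
  by apply: cinf_eqP => c; rewrite -[LHS]/((JJ 0%N (iota c) xi)%:C) J0 lfunE.
apply: (invariants_deformation e_basis).
- exact: qrepC_linear h_homotopy.
- exact: qrepC_real h_homotopy.
- exact: qrepC_rep e_basis JJ_momentum J_inj J_vanish h_homotopy.
- move=> xi F; rewrite /qrepC (qpullback_order0 h_homotopy).
  rewrite (qrepM_restrict _ _ xiC_restricted) /=.
  by have [_ -> _ _ _] := h_homotopy.
- exact: H1_vanishes.
Qed.
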